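(* Let $n \ge 7$ and $q \in \left[\frac{4\log n}{n}, \frac{1}{2}\right]$. For each $p\in[q,2q]$ let $v_p$ be an eigenvector of $A_p$ corresponding to its largest eigenvalue, with $\|v_p\|_2=1$ and with nonnegative components. Then, with probability at least $1 - 4\exp(-nq/64)$, $$\sup_{p \in [q, 2q]}\left\|v_p - \frac{\overline{1}}{\sqrt{n}}\right\|_{2} \le \frac{2896}{\sqrt{nq}}.$$
   Context: For a positive integer $n$, let $(U_{i,j})_{1\le i<j\le n}$ be independent random variables uniformly distributed on $[0,1]$. For $p\in[0,1]$, the adjacency matrix $A_p$ of the Erdős–Rényi random graph $G(n,p)$ is the symmetric $n\times n$ matrix with zero diagonal and with entries $A^{(p)}_{i,j}=A^{(p)}_{j,i}=\mathbf{1}_{U_{i,j}<p}$ for $1\le i<j\le n$. All matrices $A_p$, $p\in[0,1]$, are built from the same variables $U_{i,j}$. $\overline{1}\in\mathbb{R}^n$ is the vector whose components are all equal to $1$, and $\|\cdot\|_2$ is the Euclidean norm. By the Perron–Frobenius theorem, a unit eigenvector for the largest eigenvalue with nonnegative components always exists. $\log$ is the natural logarithm. *)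

(* Defs.v *)
(* MathComp / MathComp-Analysis. *)
From HB Require Import structures.
From mathcomp Require Import all_boot all_order all_algebra.
From mathcomp Require Import all_classical all_reals all_analysis.
Set Implicit Arguments.
Unset Strict Implicit.
Unset Printing Implicit Defensive.
Import Order.TTheory GRing.Theory Num.Theory.
Import numFieldNormedType.Exports.
Local Open Scope classical_set_scope.
Local Open Scope ring_scope.

(* The library's norm `|v| on matrices is the sup norm. *)
Definition l2norm (R : realType) (n : nat) (v : 'rV[R]_n) : R :=
  Num.sqrt (\sum_(i < n) v 0 i ^+ 2).

Definition largest_eigenvalue (R : realType) (n : nat) (A : 'M[R]_n) (a : R)
    : Prop :=
  eigenvalue A a /\ (forall b : R, eigenvalue A b -> b <= a).

(* Vectors are rows, and [eigenspace A a] is the space of v with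
   v *m A = a *: v; below A is symmetric, so left and right eigenvectors
   coincide.  The eigenspace may have dimension > 1, hence a predicate rather
   than a function of A. *)
Definition perron_vector (R : realType) (n : nat) (A : 'M[R]_n) (v : 'rV[R]_n)
    : Prop :=
  exists a : R, [/\ largest_eigenvalue A a, (v <= eigenspace A a)%MS,
    l2norm v = 1 & forall i, 0 <= v 0 i].

Section RandomGraph.
Context (R : realType) (d : measure_display) (T : measurableType d)
  (P : probability T R).

Definition uniform01 (X : {RV P >-> R}) : Prop :=
  forall B : set R, measurable B ->
    distribution P X B = uniform_prob (@ltr01 R) B.

(* Mutual independence of the subfamily of X indexed by D. *)
Definition independent_on (I : finType) (D : {set I}) (X : I -> {RV P >-> R})
    : Prop :=
  forall (J : {set I}) (B : I -> set R), J \subset D ->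
    (forall i, i \in J -> measurable (B i)) ->
    P (\bigcap_(i in [set` J]) (X i @^-1` B i)) =
    (\prod_(i in J) P (X i @^-1` B i))%E.

(* Only the variables U i j with i < j are constrained here and used in
   [adjacency]; the other ones play no role. *)
Definition iid_uniform_edges (n : nat) (U : 'I_n -> 'I_n -> {RV P >-> R})
    : Prop :=
  (forall i j : 'I_n, (i < j)%N -> uniform01 (U i j)) /\
  independent_on [set e : 'I_n * 'I_n | (e.1 < e.2)%N] (fun e => U e.1 e.2).

Definition adjacency (n : nat) (U : 'I_n -> 'I_n -> {RV P >-> R}) (p : R)
    (w : T) : 'M[R]_n :=
  \matrix_(i, j) (if (i < j)%N then (U i j w < p)%R%:R
                  else if (j < i)%N then (U j i w < p)%R%:R
                  else 0).

(* "S holds with probability at least c", for a possibly non-measurable S: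
   S contains a measurable event of probability at least c. *)
Definition with_probability_ge (c : R) (S : set T) : Prop :=
  exists E : set T, [/\ measurable E, E `<=` S & (c%:E <= P E)%E].

End RandomGraph.

(* Main.v *)
Require Import Defs.
From mathcomp Require Import all_boot all_order all_algebra.
From mathcomp Require Import all_classical all_reals all_analysis.
From mathcomp Require Import ring lra zify.
Import Order.TTheory GRing.Theory Num.Theory.
Import numFieldNormedType.Exports.
Local Open Scope ring_scope.
Set Implicit Arguments.
Unset Strict Implicit.

(** The vector u = (1, ..., 1) / sqrt n is an approximate eigenvector of A_p, and it
    remains to see that A_p has no competing large eigenvalue.  Let d = n q.  Since
    two nonnegative unit vectors are at distance at most sqrt 2, the bound is
    trivial unless d > 2896 ^ 2 / 2, and a large d is what makes crude estimates
    sufficient: a quadratic form bound of order d, instead of the true order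
    sqrt d, is enough.

    The deterministic part is [perron_perturbation].  Let v be the nonnegative
    eigenvector with eigenvalue lam, al = <u, v>, w = v - al u, and
    r = A_p u - n p u.  As v is nonnegative, lam is an average of degrees, so it is
    at least the minimum degree, which is at least d / 4.  If
    x (A_p - p J) x <= d |x| ^ 2 / 5 for nonnegative x, then
    lam = v A_p v <= n p al ^ 2 + d / 5 forces al to be bounded below; then
    (lam - n p) al = <v, r> shows that lam is close to n p, and
    lam |w| ^ 2 = al <r, w> + w (A_p - p J) w gives |w| = O(|r| / d) as soon as the
    form is at most 2 d / 5 on all unit vectors.  It remains that |r| = O(sqrt d).

    The form bound comes from cut sums alone ([nonneg_form_le]).  If the sum of a
    matrix W over S x T is at most eps sqrt(|S| |T|), and also at most C |S| and
    C |T|, then writing x and y as sums of indicators of their superlevel sets and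
    applying a Schur test gives |x W y| <= (eps log M + C / M) (|x| ^ 2 + |y| ^ 2)
    up to constants: levels whose ratio is below M use the first bound, the other
    ones the bounds by C.

    The cut sums and the degrees are controlled at a fixed p by Chernoff bounds
    ([atypical_tail]).  For sets S, T of very different sizes the degree bound
    already gives the cut estimate; for the other ones a union bound over pairs of
    sets works, with a Gaussian tail for large sets and a Poisson tail for small
    ones.  For |r| a union bound over integer vectors k recording the rounded
    degree deviations in units of sqrt d works, because the event that every
    deviation is at least its k_i has probability at most exp(- |k| ^ 2 / 16).

    Finally A_p is monotone in p, so that all these estimates pass from a grid of
    about sqrt d values of p to the whole interval ([perron_close]), and a union
    bound over the grid concludes. *)

(** * Elementary bounds on the exponential *)

Section ExpBounds.
Context (R : realType).
Implicit Types x y : R.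

(** The function (1 + x + x ^ 2) exp (- x) has derivative x (1 - x) exp (- x), so on
    [0, 1] it is at least its value 1 at 0. *)
Lemma expR_le_sqr x : x <= 1 -> expR x - 1 - x <= x ^+ 2.
Proof.
move=> x1; have [x0|x0] := lerP x 0.
  have h : expR x * (1 - x) <= 1.
    rewrite -[leRHS](expRxMexpNx_1 x) ler_wpM2l ?expR_ge0 //.
    exact: expR_ge1Dx.
  have := expR_gt0 x; nra.
pose h y : R := (1 + y + y ^+ 2) * expR (- y).
have dh (y : R) : is_derive y 1 h (y * (1 - y) * expR (- y)).
  apply: is_derive_eq; rewrite /GRing.scale /=; ring.
have [|c] := MVT x0 (fun y _ => dh y).
  by apply: continuous_subspaceT => y; apply: differentiable_continuous; apply/derivable1_diffP; have [] := dh y.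
rewrite in_itv /= => /andP[c0 cx] hx.
have : 1 <= h x.
  have h0 : h 0 = 1 by rewrite /h oppr0 expR0; ring.
  rewrite -h0 -subr_ge0 hx subr0 !mulr_ge0 ?expR_ge0 ?(ltW c0) ?(ltW x0) //; lra.
have e0 := expR_gt0 x; have := expRxMexpNx_1 x; rewrite /h => e1 h1.
have : expR x * 1 <= expR x * ((1 + x + x ^+ 2) * expR (- x)).
  by rewrite ler_pM2l.
rewrite mulrCA e1; lra.
Qed.

Lemma expR1_le3 : expR 1 <= 3 :> R.
Proof. by have := @expR_le_sqr 1 (lexx _); lra. Qed.

Lemma expR1_ge : 9 / 4 <= expR 1 :> R.
Proof.
have h := expR_ge1Dx (1 / 2 : R).
have -> : expR 1 = expR (1 / 2) * expR (1 / 2) :> R by rewrite -expRD; congr expR; lra.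
move: (expR _) h => e h; nra.
Qed.

Lemma expRN1_le : expR (- 1) <= 4 / 9 :> R.
Proof.
by rewrite expRN -[leRHS]invrK lef_pV2 ?posrE ?expR_gt0 ?invf_div ?divr_gt0 //;
   exact: expR1_ge.
Qed.

Lemma ln2_le : ln 2 <= 3 / 4 :> R.
Proof.
rewrite -[leRHS]expRK ler_ln ?posrE ?expR_gt0 //.
have -> : 3 / 4 = 5%:R * (3 / 20) :> R by lra.
rewrite expRM_natl; have h := expR_ge1Dx (3 / 20 : R).
by apply: (le_trans _ (lerXn2r 5 _ _ h)); rewrite ?nnegrE ?expR_ge0 //; lra.
Qed.

End ExpBounds.

(** * Product Bernoulli measures on a finite set *)

Section FiniteProduct.
Context (R : realType) (I : finType) (f : I -> R).
Hypothesis f01 : forall e, 0 <= f e <= 1.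

Definition bernoulli_weight (G : {set I}) : R :=
  \prod_e (if e \in G then f e else 1 - f e).

Definition bernoulli_pr (Q : {set I} -> bool) : R :=
  \sum_(G : {set I} | Q G) bernoulli_weight G.

Lemma bernoulli_weight_ge0 G : 0 <= bernoulli_weight G.
Proof.
by apply: prodr_ge0 => e _; case/andP: (f01 e) => *; case: ifP; rewrite ?subr_ge0.
Qed.

Lemma bernoulli_pr_mono (Q Q' : {set I} -> bool) :
  (forall G, Q G -> Q' G) -> bernoulli_pr Q <= bernoulli_pr Q'.
Proof.
move=> QQ'; rewrite /bernoulli_pr [leLHS]big_mkcond [leRHS]big_mkcond /=.
apply: ler_sum => G _; case: ifPn => [/QQ' -> //|_].
by case: ifP => _ //; exact: bernoulli_weight_ge0.
Qed.

Lemma bernoulli_pr_union (K : finType) (C : K -> bool)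
    (Q : {set I} -> bool) (Q' : K -> {set I} -> bool) :
  (forall G, Q G -> exists2 k, C k & Q' k G) ->
  bernoulli_pr Q <= \sum_(k | C k) bernoulli_pr (Q' k).
Proof.
move=> QQ'; rewrite /bernoulli_pr.
under [leRHS]eq_bigr do rewrite big_mkcond /=.
rewrite exchange_big big_mkcond /=; apply: ler_sum => G _.
have ge0 (k : K) : C k -> 0 <= (if Q' k G then bernoulli_weight G else 0).
  by move=> _; case: ifP => _ //; exact: bernoulli_weight_ge0.
case: ifPn => [/QQ' [k Ck Qk]|_]; last exact: sumr_ge0.
rewrite (bigD1 k) //= Qk lerDl; apply: sumr_ge0 => j /andP[Cj _]; exact: ge0.
Qed.

(** Markov's inequality for the exponential of a linear form; the product measure
    turns the expectation into a product of sums, and each factor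
    1 + f e (exp (c e) - 1) is below an exponential. *)
Lemma chernoff (c : I -> R) (t : R) :
  bernoulli_pr (fun G => t <= \sum_(e in G) c e) <=
  expR (\sum_e f e * (expR (c e) - 1) - t).
Proof.
apply: (@le_trans _ _ (\sum_(G : {set I})
   expR (\sum_(e in G) c e - t) * bernoulli_weight G)).
  rewrite /bernoulli_pr big_mkcond /=; apply: ler_sum => G _.
  have w0 := bernoulli_weight_ge0 G.
  case: ifPn => tG; last by rewrite mulr_ge0 // expR_ge0.
  by rewrite ler_peMl // -expR0 ler_expR subr_ge0.
under eq_bigr => G _.
  rewrite expRB mulrAC expR_sum /bernoulli_weight big_mkcond /= -big_split /=.
  under eq_bigr => e _.
    have -> : (if e \in G then expR (c e) else 1) *
        (if e \in G then f e else 1 - f e) =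
        (if e \in G then expR (c e) * f e else 1 - f e).
      by case: ifP => _; rewrite ?mul1r.
    over.
  over.
rewrite -mulr_suml -bigA_distr /= [leRHS]expRB expR_sum ler_pM2r; last first.
  by rewrite invr_gt0 expR_gt0.
apply: ler_prod => e _; case/andP: (f01 e) => fe0 fe1.
rewrite addr_ge0 ?subr_ge0 ?mulr_ge0 ?expR_ge0 //=.
apply: le_trans (expR_ge1Dx _); lra.
Qed.

Lemma chernoff_centered (c : I -> R) (t : R) :
  bernoulli_pr (fun G => t <= \sum_e c e * ((e \in G)%:R - f e)) <=
  expR (\sum_e f e * (expR (c e) - 1 - c e) - t).
Proof.
have -> : \sum_e f e * (expR (c e) - 1 - c e) - t =
   \sum_e f e * (expR (c e) - 1) - (t + \sum_e f e * c e).
  under eq_bigr do rewrite mulrBr.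
  rewrite sumrB; lra.
apply: le_trans (chernoff _ _); apply: bernoulli_pr_mono => G.
have -> // : \sum_e c e * ((e \in G)%:R - f e) =
   \sum_(e in G) c e - \sum_e f e * c e; last by rewrite lerBrDr.
rewrite [X in X - _]big_mkcond /= -sumrB; apply: eq_bigr => e _.
by rewrite mulrBr [c e * f e]mulrC; case: (e \in G); rewrite ?mulr1 ?mulr0.
Qed.

End FiniteProduct.


(** * From cut sums to quadratic forms *)

Section HarmonicWindow.
Context (R : realType).

Lemma sum_inv_le_ln (a b : nat) : (0 < a)%N -> (a <= b)%N ->
  \sum_(a <= l < b.+1) l%:R^-1 <= 1 + (ln b%:R - ln a%:R) :> R.
Proof.
move=> a0; elim: b => [|b IH]; first by case: a a0.
rewrite leq_eqVlt => /orP[/eqP <-|].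
  rewrite big_nat1 subrr addr0 invf_le1 ?ltr0n //; by rewrite ler1n.
rewrite ltnS => ab; have b0 := leq_trans a0 ab.
rewrite big_nat_recr /=; last by rewrite ltnW.
suff h : b.+1%:R^-1 <= ln b.+1%:R - ln b%:R :> R.
  by apply: (le_trans (lerD (IH ab) h)); rewrite -addrA lerD2l addrC addrA subrK.
have B0 : 0 < b%:R :> R by rewrite ltr0n.
have B1 : 0 < b.+1%:R :> R by rewrite ltr0n.
have : ln (b%:R / b.+1%:R) <= - b.+1%:R^-1 :> R.
  have -> : b%:R / b.+1%:R = 1 + (- b.+1%:R^-1) :> R.
    by rewrite -[X in X + _](divff (lt0r_neq0 B1)) -mulN1r -mulrDl -natr1; congr (_ / _); ring.
  apply: le_ln1Dx; rewrite ltrN2 invf_lt1 //. rewrite ltr1n; lia.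
by rewrite ln_div ?posrE // => h; rewrite -lerN2 opprB.
Qed.

(** The indices l between k / M and M k span a ratio M ^ 2, whatever k is: this
    scale invariance is what the Schur test below needs. *)
Lemma harmonic_window (M k K : nat) : (0 < k)%N -> (1 < M)%N ->
  \sum_(1 <= l < K.+1 | (k < M * l)%N && (l < M * k)%N) l%:R^-1
     <= 1 + 2 * ln M%:R :> R.
Proof.
move=> k0 M1; set a := (k %/ M).+1; set b := (M * k)%N.
have ab : (a <= b.-1)%N.
  rewrite /a /b; have := leq_divM k M; nia.
have b0 : (0 < b)%N by rewrite /b; nia.
apply: (@le_trans _ _ (\sum_(a <= l < b.-1.+1) l%:R^-1)).
  rewrite prednK //.
  rewrite (big_nat_widen _ _ (maxn K.+1 b)) ?leq_maxl //.
  rewrite [leRHS](big_nat_widen _ _ (maxn K.+1 b)) ?leq_maxr //.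
  rewrite [leRHS](big_nat_widenl _ 1) // [leLHS]big_mkcond [leRHS]big_mkcond /=.
  apply: ler_sum => l _; case: ifPn => [/andP[/andP[kl lk] _]|_].
    have al : (a <= l)%N by rewrite /a ltn_divLR 1?mulnC // ltnW.
    by rewrite lk al.
  by case: ifP => _; rewrite ?invr_ge0 ?ler0n.
apply: (le_trans (sum_inv_le_ln _ ab)) => //.
have A0 : 0 < a%:R :> R by rewrite ltr0n.
have k0' : 0 < k%:R :> R by rewrite ltr0n.
have M0 : (0 < M)%N := ltnW M1.
have M0' : 0 < M%:R :> R by rewrite ltr0n.
have b1 : (0 < b.-1)%N by exact: leq_trans ab.
have h1 : ln b.-1%:R <= ln M%:R + ln k%:R :> R.
  rewrite -lnM ?posrE // ler_ln ?posrE ?mulr_gt0 ?ltr0n //.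
  by rewrite -natrM ler_nat leq_pred.
have h2 : ln k%:R <= ln M%:R + ln a%:R :> R.
  rewrite -lnM ?posrE // ler_ln ?posrE ?mulr_gt0 //.
  by rewrite -natrM ler_nat ltnW // mulnC -ltn_divLR //; lia.
move: (ln b.-1%:R) (ln a%:R) (ln M%:R) (ln k%:R) h1 h2 => u v w z h1 h2; lra.
Qed.

End HarmonicWindow.

Section SchurTest.
Context (R : realType) (M K : nat) (eps C : R).
Hypotheses (M1 : (1 < M)%N) (eps0 : 0 <= eps) (C0 : 0 <= C).

(** The part of the entry (k, l) that is charged to row k: everything if k is much
    larger than l, and for comparable indices half of the right-hand side of the
    inequality 2 sqrt(s t) <= s k / l + t l / k. *)
Let share (s : R) (k l : nat) : R :=
  if (M * l <= k)%N then C * s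
  else if (k < M * l)%N && (l < M * k)%N then eps / 2 * (s * k%:R / l%:R)
  else 0.

Let share_row (s : R) (k : nat) : 0 <= s -> (0 < k)%N ->
  \sum_(1 <= l < K.+1) share s k l <=
  (eps / 2 * (1 + 2 * ln M%:R) + C / M%:R) * (k%:R * s).
Proof.
move=> s0 k0.
have M0 : (0 < M)%N := ltnW M1.
have M0' : 0 < M%:R :> R by rewrite ltr0n.
apply: (@le_trans _ _ (\sum_(1 <= l < K.+1 | (M * l <= k)%N) C * s +
   \sum_(1 <= l < K.+1 | (k < M * l)%N && (l < M * k)%N)
      eps / 2 * (s * k%:R / l%:R))).
  rewrite [X in _ <= X + _]big_mkcond [X in _ <= _ + X]big_mkcond -big_split /=.
  apply: ler_sum => l _; rewrite /share; case: ifPn => [h|h].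
    by rewrite lerDl; case: ifP => // _; rewrite !mulr_ge0 ?invr_ge0 ?ler0n.
  by rewrite add0r.
rewrite mulrDl addrC lerD //.
  rewrite -!mulr_sumr -[leRHS]mulrA ler_wpM2l ?divr_ge0 //.
  by rewrite mulrC [s * _]mulrC ler_wpM2r ?mulr_ge0 ?ler0n // harmonic_window.
have -> : C / M%:R * (k%:R * s) = C * s * (k%:R / M%:R) by ring.
rewrite big_const_seq iter_addr_0 -[leLHS]mulr_natr ler_wpM2l ?mulr_ge0 //.
rewrite ler_pdivlMr // -natrM ler_nat.
apply: (@leq_trans ((k %/ M) * M)%N); last exact: leq_divM.
rewrite leq_mul2r; apply/orP; right.
have -> : (k %/ M)%N = count (fun l => (M * l <= k)%N) (index_iota 1 (k %/ M).+1).
  rewrite -[LHS](size_iota 1); apply/esym/eqP; rewrite /index_iota subSS subn0 -all_count.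
  by apply/allP => l; rewrite mem_iota add1n ltnS => /andP[_ hl] /=; rewrite mulnC -leq_divRL.
rewrite -!sum1_count.
rewrite [leqLHS](big_nat_widen _ _ (maxn K.+1 (k %/ M).+1)) ?leq_maxl //.
rewrite [leqRHS](big_nat_widen _ _ (maxn K.+1 (k %/ M).+1)) ?leq_maxr //.
rewrite big_mkcond [leqRHS]big_mkcond /=; apply: leq_sum => l _.
case: ifP => // /andP[h _]; rewrite h /=.
by rewrite ltnS leq_divRL // (mulnC l) h.
Qed.

(** Each entry is charged to its row and its column by [share]; the weights k / l
    are those for which the row sums become harmonic sums over a window. *)
Lemma schur_sum_le (D : nat -> nat -> R) (s t : nat -> R) :
  (forall k, 0 <= s k) -> (forall l, 0 <= t l) ->
  (forall k l, D k l <= eps * Num.sqrt (s k * t l)) ->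
  (forall k l, D k l <= C * s k) -> (forall k l, D k l <= C * t l) ->
  \sum_(1 <= k < K.+1) \sum_(1 <= l < K.+1) D k l <=
  (eps / 2 * (1 + 2 * ln M%:R) + C / M%:R) *
  (\sum_(1 <= k < K.+1) k%:R * s k + \sum_(1 <= l < K.+1) l%:R * t l).
Proof.
move=> s0 t0 De Ds Dt.
have share0 u k l : 0 <= u -> 0 <= share u k l.
  by move=> u0; rewrite /share; do 2?case: ifP => _ //; rewrite !mulr_ge0 ?invr_ge0 ?ler0n.
rewrite mulrDr !mulr_sumr.
apply: (@le_trans _ _ (\sum_(1 <= k < K.+1) \sum_(1 <= l < K.+1)
   (share (s k) k l + share (t l) l k))).
  rewrite !big_nat; apply: ler_sum => k /andP[k1 _].
  rewrite !big_nat; apply: ler_sum => l /andP[l1 _].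
  have [h|h] := leqP (M * l) k.
    by rewrite {1}/share h (le_trans (Ds k l)) // lerDl share0.
  have [h'|h'] := leqP (M * k) l.
    by rewrite {2}/share h' (le_trans (Dt k l)) // lerDr share0.
  rewrite /share (leqNgt (M * l)) h (leqNgt (M * k)) h' /=.
  apply: (le_trans (De k l)).
  rewrite -mulrDr -mulrA ler_wpM2l //.
  have K0 : 0 < k%:R :> R by rewrite ltr0n.
  have L0 : 0 < l%:R :> R by rewrite ltr0n.
  set a := s k * k%:R / l%:R; set b := t l * l%:R / k%:R.
  have -> : s k * t l = a * b.
    by rewrite /a /b; field; rewrite !lt0r_neq0.
  have a0 : 0 <= a by rewrite !mulr_ge0 ?invr_ge0 ?ler0n.
  have b0 : 0 <= b by rewrite !mulr_ge0 ?invr_ge0 ?ler0n.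
  rewrite sqrtrM // -{2}(sqr_sqrtr a0) -{2}(sqr_sqrtr b0).
  have := sqr_ge0 (Num.sqrt a - Num.sqrt b); rewrite sqrrB; lra.
under eq_bigr do rewrite big_split /=.
rewrite big_split /= lerD //; last rewrite exchange_big /=.
  by rewrite !big_nat; apply: ler_sum => k /andP[k1 _]; exact: share_row.
by rewrite !big_nat; apply: ler_sum => k /andP[k1 _]; exact: share_row.
Qed.

End SchurTest.

Section LayerCake.
Context (R : realType).

Lemma sum_layers (x K : nat) : (x <= K)%N ->
  \sum_(1 <= k < K.+1) (k <= x)%:R = x%:R :> R.
Proof.
move=> xK; rewrite -[in RHS](minn_idPl xK) {xK}.
elim: K => [|K IH]; first by rewrite big_nil minn0.
rewrite big_nat_recr //= IH -natrD; congr _%:R.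
by case: leqP => h; rewrite /minn; do ?case: ifP; lia.
Qed.

Lemma sum_weighted_layers (x K : nat) : (x <= K)%N ->
  \sum_(1 <= k < K.+1) k%:R * (k <= x)%:R = x%:R * (x%:R + 1) / 2 :> R.
Proof.
move=> xK; rewrite -[in RHS](minn_idPl xK) {xK}.
elim: K => [|K IH]; first by rewrite big_nil minn0 mul0r mul0r.
rewrite big_nat_recr // IH [Monoid.Law.sort _]/=.
case: (boolP (K.+1 <= x)%N) => h.
  have -> : minn x K.+1 = K.+1 by lia.
  have -> : minn x K = K by lia.
  by rewrite /= mulr1 -!natr1; field.
have -> : minn x K.+1 = x by lia.
have -> : minn x K = x by lia.
by rewrite /= mulr0 addr0.
Qed.

Context (I : finType) (W : I -> I -> R) (M : nat) (eps C : R).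
Hypotheses (M1 : (1 < M)%N) (eps0 : 0 <= eps) (C0 : 0 <= C).
Hypothesis cut_mean : forall S T : {set I},
  `|\sum_(i in S) \sum_(j in T) W i j| <= eps * Num.sqrt (#|S|%:R * #|T|%:R).
Hypothesis cut_row : forall S T : {set I},
  `|\sum_(i in S) \sum_(j in T) W i j| <= C * #|S|%:R.
Hypothesis cut_col : forall S T : {set I},
  `|\sum_(i in S) \sum_(j in T) W i j| <= C * #|T|%:R.

Let kappa := eps / 2 * (1 + 2 * ln M%:R) + C / M%:R.

Let kappa0 : 0 <= kappa.
Proof.
rewrite addr_ge0 ?divr_ge0 ?ler0n // mulr_ge0 ?divr_ge0 //.
by rewrite addr_ge0 // mulr_ge0 // ln_ge0 // ler1n ltnW.
Qed.

(** With S_k the set where x is at least k, x is the sum of the indicators of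
    S_1, S_2, ..., and the sum of k |S_k| is that of x_i (x_i + 1) / 2. *)
Lemma nat_form_le (x y : I -> nat) :
  `|\sum_i \sum_j (x i)%:R * (y j)%:R * W i j| <=
  kappa / 2 * (\sum_i (x i)%:R * ((x i)%:R + 1) + \sum_j (y j)%:R * ((y j)%:R + 1)).
Proof.
pose K := (\sum_i x i + \sum_j y j)%N.
have xK i : (x i <= K)%N.
  by rewrite /K (bigD1 i) //= -addnA leq_addr.
have yK j : (y j <= K)%N.
  by rewrite /K addnC (bigD1 j) //= -addnA leq_addr.
pose S k := [set i | (k <= x i)%N]; pose T l := [set j | (l <= y j)%N].
have -> : \sum_i \sum_j (x i)%:R * (y j)%:R * W i j =
   \sum_(1 <= k < K.+1) \sum_(1 <= l < K.+1)
     \sum_(i in S k) \sum_(j in T l) W i j.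
  under eq_bigr => i _.
    under eq_bigr => j _.
      rewrite -(sum_layers (xK i)) -(sum_layers (yK j)) !mulr_suml.
      under eq_bigr => k _ do rewrite mulr_sumr mulr_suml.
      over.
    rewrite exchange_big /=.
    under eq_bigr => k _ do rewrite exchange_big /=.
    over.
  rewrite exchange_big /=; apply: eq_bigr => k _.
  rewrite exchange_big /=; apply: eq_bigr => l _.
  rewrite /S /T [RHS]big_mkcond /=; apply: eq_bigr => i _.
  rewrite inE; case: leqP => _; last by rewrite big1 // => j _; rewrite !mul0r.
  rewrite [RHS]big_mkcond /=; apply: eq_bigr => j _.
  by rewrite inE; case: leqP => _; rewrite ?mulr0 ?mul0r ?mul1r.
have wS (z : I -> nat) : (forall i, (z i <= K)%N) ->
   \sum_(1 <= k < K.+1) k%:R * #|[set i | (k <= z i)%N]|%:R =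
   (\sum_i (z i)%:R * ((z i)%:R + 1)) / 2 :> R.
  move=> zK; rewrite mulr_suml.
  under [RHS]eq_bigr do rewrite -(sum_weighted_layers (zK _)).
  rewrite exchange_big /=; apply: eq_bigr => k _.
  rewrite -mulr_sumr -sum1_card natr_sum big_mkcond /=; congr (_ * _).
  by apply: eq_bigr => i _; rewrite inE; case: leqP.
apply: (le_trans (ler_norm_sum _ _ _)).
apply: (@le_trans _ _ (\sum_(1 <= k < K.+1) \sum_(1 <= l < K.+1)
     `|\sum_(i in S k) \sum_(j in T l) W i j|)).
  by apply: ler_sum => k _; exact: ler_norm_sum.
apply: (le_trans (@schur_sum_le _ M K eps C M1 eps0 C0 _
   (fun k => #|S k|%:R) (fun l => #|T l|%:R) _ _ _ _ _)) => //.
by rewrite (wS x) // (wS y) // -mulrDl -/kappa [leRHS]mulrAC mulrA.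
Qed.

(** Apply the integer case to the integer parts of N x and N y, divide by N ^ 2 and
    let N tend to infinity. *)
Lemma nonneg_form_le (x y : I -> R) :
  (forall i, 0 <= x i) -> (forall j, 0 <= y j) ->
  `|\sum_i \sum_j x i * y j * W i j| <=
  kappa / 2 * (\sum_i x i ^+ 2 + \sum_j y j ^+ 2).
Proof.
move=> x0 y0.
set F := \sum_i _; set Q := \sum_i _ + _.
pose c := \sum_i \sum_j (x i + y j) * `|W i j| +
  kappa / 2 * (\sum_i x i + \sum_j y j).
(* Both sides are homogeneous of degree 2, so the rounding error and the linear
   terms of the integer estimate carry only one factor N. *)
have step (N : nat) : N%:R ^+ 2 * `|F| <= N%:R ^+ 2 * (kappa / 2 * Q) + N%:R * c.
  pose X i := Num.truncn (N%:R * x i); pose Y j := Num.truncn (N%:R * y j).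
  have N0 : 0 <= N%:R :> R := ler0n _ _.
  have tr (z : R) : 0 <= z -> (Num.truncn (N%:R * z))%:R <= N%:R * z /\
      N%:R * z - (Num.truncn (N%:R * z))%:R <= 1.
    move=> z0; have /truncn_itv/andP[h1 h2] : 0 <= N%:R * z by rewrite mulr_ge0.
    by split => //; rewrite -natr1 in h2; lra.
  have := nat_form_le X Y; set G := \sum_i _ => hG.
  have FG : `|N%:R ^+ 2 * F - G| <= N%:R * \sum_i \sum_j (x i + y j) * `|W i j|.
    rewrite /F /G mulr_sumr -sumrB mulr_sumr; apply: (le_trans (ler_norm_sum _ _ _)).
    apply: ler_sum => i _; rewrite mulr_sumr -sumrB mulr_sumr.
    apply: (le_trans (ler_norm_sum _ _ _)); apply: ler_sum => j _.
    rewrite !mulrA -mulrBl normrM ler_wpM2r ?normr_ge0 //.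
    have [hx1 hx2] := tr _ (x0 i); have [hy1 hy2] := tr _ (y0 j).
    rewrite -/(X i) -/(Y j) in hx1 hx2 hy1 hy2.
    move: (ler0n R (X i)) (ler0n R (Y j)) hx1 hx2 hy1 hy2.
    have -> : N%:R ^+ 2 * x i * y j = (N%:R * x i) * (N%:R * y j) by ring.
    rewrite mulrDr; move: (N%:R * x i) (N%:R * y j) (X i)%:R (Y j)%:R => a b a' b'.
    by move=> *; rewrite ler_norml; apply/andP; split; nra.
  have hX : \sum_i (X i)%:R * ((X i)%:R + 1) <=
      N%:R ^+ 2 * \sum_i x i ^+ 2 + N%:R * \sum_i x i.
    rewrite !mulr_sumr -big_split /=; apply: ler_sum => i _.
    have [h _] := tr _ (x0 i); rewrite -/(X i) in h; rewrite -exprMn.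
    by have := ler0n R (X i); nra.
  have hY : \sum_i (Y i)%:R * ((Y i)%:R + 1) <=
      N%:R ^+ 2 * \sum_i y i ^+ 2 + N%:R * \sum_i y i.
    rewrite !mulr_sumr -big_split /=; apply: ler_sum => i _.
    have [h _] := tr _ (y0 i); rewrite -/(Y i) in h; rewrite -exprMn.
    by have := ler0n R (Y i); nra.
  have := ler_wpM2l (divr_ge0 kappa0 (ler0n R 2)) (lerD hX hY).
  move: hG FG; rewrite -[N%:R ^+ 2 * `|F|]ger0_norm ?mulr_ge0 ?exprn_ge0 //.
  rewrite normrM normr_id -normrM /c /Q.
  have := lerB_dist (N%:R ^+ 2 * F) G; set A := \sum_i \sum_j _.
  move: (\sum_i (X i)%:R * _) (\sum_i (Y i)%:R * _) => a b h1 h2 h3 h4.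
  by lra.
have [//|lt] := leP (`|F|) (kappa / 2 * Q).
pose dl := `|F| - kappa / 2 * Q.
have dl0 : 0 < dl by rewrite subr_gt0.
have hN (N : nat) : N%:R * dl <= c.
  case: N => [|N].
    rewrite mul0r; apply: addr_ge0.
      apply: sumr_ge0 => i _; apply: sumr_ge0 => j _.
      by rewrite mulr_ge0 ?addr_ge0.
    by apply: mulr_ge0; [exact: divr_ge0|rewrite addr_ge0 ?sumr_ge0].
  have N0 : 0 < N.+1%:R :> R by rewrite ltr0n.
  have := step N.+1; rewrite expr2 -!(mulrA N.+1%:R N.+1%:R) -mulrDr ler_pM2l //.
  by rewrite /dl mulrBr lerBlDl.
have := hN (Num.truncn (c / dl)).+1; rewrite leNgt -ltr_pdivrMr //.
by rewrite truncnS_gt.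
Qed.

End LayerCake.

(** * Perturbation of a nonnegative eigenvector *)

Section PerronPerturbation.
Context (R : realType).

(** Lagrange's identity. *)
Lemma cauchy_schwarz_sum (I : finType) (a b : I -> R) :
  (\sum_i a i * b i) ^+ 2 <= (\sum_i a i ^+ 2) * (\sum_i b i ^+ 2).
Proof.
rewrite -subr_ge0 -(@pmulr_rge0 _ 2) //.
suff -> : 2 * ((\sum_i a i ^+ 2) * (\sum_i b i ^+ 2) - (\sum_i a i * b i) ^+ 2) =
    \sum_i \sum_j (a i * b j - a j * b i) ^+ 2.
  by apply: sumr_ge0 => i _; apply: sumr_ge0 => j _; exact: sqr_ge0.
under [RHS]eq_bigr => i _.
  under eq_bigr => j _.
    have -> : (a i * b j - a j * b i) ^+ 2 = a i ^+ 2 * b j ^+ 2 +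
       b i ^+ 2 * a j ^+ 2 - 2 * (a i * b i) * (a j * b j) by ring.
    over.
  rewrite sumrB big_split /= -!mulr_sumr.
  over.
rewrite sumrB big_split /= -!mulr_suml -mulr_sumr; ring.
Qed.

(** The nonnegativity of v makes lam an average of degrees.  From this first crude
    lower bound on lam the overlap al of v with the constant unit vector u is
    bounded below, which in turn locates lam near n p and makes w = v - al u
    small. *)
Lemma perron_perturbation (n : nat) (A : 'I_n -> 'I_n -> R) (v : 'I_n -> R)
    (lam p D : R) :
  (0 < n)%N -> 0 < D -> D <= n%:R * p <= 2 * D ->
  (forall i j, A i j = A j i) ->
  (forall i, 0 <= v i) -> \sum_i v i ^+ 2 = 1 ->
  (forall j, \sum_i v i * A i j = lam * v j) ->
  (forall i, D / 4 <= \sum_j A i j) ->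
  (forall x : 'I_n -> R, (forall i, 0 <= x i) ->
     \sum_i \sum_j x i * x j * (A i j - p) <= D / 5 * \sum_i x i ^+ 2) ->
  (forall x : 'I_n -> R,
     \sum_i \sum_j x i * x j * (A i j - p) <= 2 * D / 5 * \sum_i x i ^+ 2) ->
  \sum_i (\sum_j A i j - n%:R * p) ^+ 2 <= n%:R * (D / 31) ^+ 2 ->
  \sum_i (v i - 1 / Num.sqrt n%:R) ^+ 2 <=
    14 / D ^+ 2 * ((\sum_i (\sum_j A i j - n%:R * p) ^+ 2) / n%:R).
Proof.
move=> n0 D0 /andP[Dp pD] symA v0 v1 eig mindeg form0 form res.
set deg := fun i => \sum_j A i j.
set e := fun i => deg i - n%:R * p.
set r2 := _ / n%:R.
set u := 1 / Num.sqrt n%:R.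
have nR : 0 < n%:R :> R by rewrite ltr0n.
have u0 : 0 < u by rewrite divr_gt0 // sqrtr_gt0.
have u2 : n%:R * u ^+ 2 = 1.
  by rewrite expr_div_n sqr_sqrtr ?ltW // expr1n mul1r divff // lt0r_neq0.
pose s := \sum_i v i; pose al := u * s.
have e2 : \sum_i e i ^+ 2 = n%:R * r2.
  by rewrite /r2 mulrCA divff ?mulr1 // lt0r_neq0.
have r20 : 0 <= r2 by rewrite /r2 divr_ge0 ?sumr_ge0 // => i _; exact: sqr_ge0.
have r2D : r2 <= (D / 31) ^+ 2 by rewrite -(ler_pM2l nR) -e2.
have s0 : 0 < s.
  rewrite lt0r sumr_ge0 // andbT; apply/eqP => s0.
  have : \sum_i v i ^+ 2 = 0.
    rewrite big1 // => i _; move/eqP: s0; rewrite psumr_eq0 //.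
    by move=> /allP /(_ i (mem_index_enum _)) /eqP ->; rewrite expr0n.
  by rewrite v1 => /eqP; rewrite oner_eq0.
have al2 : al ^+ 2 * n%:R = s ^+ 2.
  by rewrite /al exprMn mulrAC [_ * n%:R]mulrC u2 mul1r.
have al0 : 0 < al by rewrite mulr_gt0.
(* lam is the average of the degrees with weights v, hence at least the minimum
   degree. *)
have lams : lam * s = \sum_i v i * deg i.
  rewrite /s mulr_sumr; under eq_bigr do rewrite -eig.
  by rewrite exchange_big /=; apply: eq_bigr => i _; rewrite -mulr_sumr.
have lam1 : D / 4 <= lam.
  rewrite -(ler_pM2r s0) lams mulr_sumr; apply: ler_sum => i _.
  by rewrite mulrC ler_wpM2l //; exact: mindeg.
have quad (x y : 'I_n -> R) : \sum_i \sum_j x i * y j * (A i j - p) =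
    \sum_i \sum_j x i * y j * A i j - p * ((\sum_i x i) * (\sum_j y j)).
  under eq_bigr => i _.
    under eq_bigr => j _ do rewrite mulrBr.
    rewrite sumrB -mulr_suml -mulr_sumr.
    over.
  by rewrite sumrB -mulr_suml -mulr_suml [p * _]mulrC.
have Av (x : 'I_n -> R) : \sum_i \sum_j v i * x j * A i j = lam * \sum_j x j * v j.
  rewrite exchange_big mulr_sumr /=; apply: eq_bigr => j _.
  under eq_bigr do rewrite mulrAC.
  by rewrite -mulr_suml eig; ring.
have al40 : 1 / 40 <= al ^+ 2.
  have := form0 v v0; rewrite quad Av v1.
  rewrite -/s -expr2 -al2 !mulr1 => h.
  have h1 : D / 20 <= al ^+ 2 * (n%:R * p) by lra.
  have h2 : al ^+ 2 * (n%:R * p) <= al ^+ 2 * (2 * D) by rewrite ler_wpM2l ?sqr_ge0.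
  by rewrite -(ler_pM2r (mulr_gt0 (ltr0Sn R 1) D0)); lra.
have lam2 : 79 / 100 * D <= lam.
  have h : (lam - n%:R * p) * s = \sum_i v i * e i.
    rewrite mulrBl lams /e; under [RHS]eq_bigr do rewrite mulrBr.
    by rewrite sumrB -mulr_suml [s * _]mulrC.
  have := cauchy_schwarz_sum v e; rewrite -h v1 mul1r e2 exprMn -al2.
  rewrite mulrA [_ * n%:R]mulrC ler_pM2l // => h2.
  have h3 : (lam - n%:R * p) ^+ 2 * (1 / 40) <= (D / 31) ^+ 2.
    by apply: (le_trans _ (le_trans h2 r2D)); rewrite ler_wpM2l ?sqr_ge0.
  have [//|lt] := leP (79 / 100 * D) lam.
  have : (21 / 100 * D) ^+ 2 <= (lam - n%:R * p) ^+ 2.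
    rewrite -[leRHS]sqrrN; apply: lerXn2r; rewrite ?nnegrE; lra.
  have D2 : 0 < D ^+ 2 by rewrite exprn_gt0.
  move: h3; rewrite !expr_div_n exprMn; lra.
pose w i := v i - al * u.
have sumw : \sum_i w i = 0.
  rewrite sumrB sumr_const card_ord -[_ *+ n]mulr_natl /al -/s.
  have -> : n%:R * (u * s * u) = n%:R * u ^+ 2 * s by ring.
  by rewrite u2 mul1r subrr.
have N_eq : \sum_i w i ^+ 2 = 1 - al ^+ 2.
  transitivity (\sum_i (v i ^+ 2 + (- 2 * al * u) * v i + (al * u) ^+ 2)).
    by apply: eq_bigr => i _; rewrite /w; ring.
  rewrite !big_split /= -mulr_sumr v1 sumr_const card_ord -[_ *+ n]mulr_natl -/s.
  have -> : - 2 * al * u * s = - 2 * al ^+ 2 by rewrite /al; ring.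
  have -> : n%:R * (al * u) ^+ 2 = n%:R * u ^+ 2 * al ^+ 2 by ring.
  by rewrite u2; ring.
set N := \sum_i w i ^+ 2 in N_eq.
have N0 : 0 <= N by apply: sumr_ge0 => i _; exact: sqr_ge0.
have wv : \sum_j w j * v j = N.
  transitivity (\sum_j (w j ^+ 2 + al * u * w j)).
    by apply: eq_bigr => j _; rewrite /w; ring.
  by rewrite big_split /= -mulr_sumr sumw mulr0 addr0.
pose we := \sum_i w i * e i.
have lamN : lam * N <= 2 * D / 5 * N + al * u * we.
  rewrite -[in leLHS]wv -Av.
  have -> : \sum_i \sum_j v i * w j * A i j =
     \sum_i \sum_j w i * w j * (A i j - p) + al * u * we.
    rewrite quad sumw mul0r mulr0 subr0 /we /e.
    under [X in _ = _ + _ * X]eq_bigr do rewrite mulrBr.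
    rewrite sumrB -mulr_suml sumw mul0r subr0.
    rewrite [X in _ = _ + _ * X](_ : _ = \sum_i \sum_j w j * A i j); last first.
      rewrite exchange_big /=; apply: eq_bigr => j _; rewrite -mulr_sumr.
      by congr (_ * _); apply: eq_bigr => i _.
    rewrite mulr_sumr -big_split /=; apply: eq_bigr => i _.
    rewrite mulr_sumr -big_split /=; apply: eq_bigr => j _.
    by rewrite /w; ring.
  by rewrite lerD2r; apply: form.
have al1 : al ^+ 2 <= 1 by rewrite -subr_ge0 -N_eq.
have NR : 39 / 100 * D * N <= al * u * we by nra.
have cs : (al * u * we) ^+ 2 <= N * r2.
  have := cauchy_schwarz_sum w e; rewrite -/we -/N e2 => h.
  have -> : (al * u * we) ^+ 2 = al ^+ 2 * (u ^+ 2 * we ^+ 2) by ring.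
  apply: (@le_trans _ _ (1 * (u ^+ 2 * (N * (n%:R * r2))))).
    apply: ler_pM => //; first exact: sqr_ge0.
      by rewrite mulr_ge0 ?sqr_ge0.
    by apply: ler_wpM2l => //; exact: sqr_ge0.
  have -> : 1 * (u ^+ 2 * (N * (n%:R * r2))) = (n%:R * u ^+ 2) * (N * r2) by ring.
  by rewrite u2 mul1r.
have Nr : (39 / 100 * D) ^+ 2 * N <= r2.
  have [->|Npos] := eqVneq N 0; first by rewrite mulr0.
  have N0' : 0 < N by rewrite lt0r Npos.
  rewrite -(ler_pM2l N0'); apply: (le_trans _ cs).
  have -> : N * ((39 / 100 * D) ^+ 2 * N) = (39 / 100 * D * N) ^+ 2 by ring.
  by rewrite lerXn2r ?nnegrE //; [|apply: le_trans NR]; rewrite !mulr_ge0 // ltW.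
have -> : \sum_i (v i - u) ^+ 2 = 2 - 2 * al.
  transitivity (\sum_i (v i ^+ 2 + (- 2 * u) * v i + u ^+ 2)).
    by apply: eq_bigr => i _; ring.
  rewrite !big_split /= -mulr_sumr v1 sumr_const card_ord -[_ *+ n]mulr_natl -/s u2.
  by rewrite /al; ring.
have D2 : 0 < D ^+ 2 by rewrite exprn_gt0.
rewrite mulrAC ler_pdivlMr //; rewrite exprMn in Nr.
have al_N : 2 - 2 * al <= 2 * N by rewrite N_eq; nra.
apply: (le_trans (ler_wpM2r (ltW D2) al_N)).
have : 0 <= D ^+ 2 * N by rewrite mulr_ge0 // ltW.
lra.
Qed.
End PerronPerturbation.

(** * Counting subsets *)

Section Counting.
Context (R : realType).

Lemma sum_geometric_le (r : R) (m : nat) : 0 <= r < 1 ->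
  \sum_(s < m) r ^+ s <= (1 - r)^-1.
Proof.
move=> /andP[r0 r1]; have h : 0 < 1 - r by rewrite subr_gt0.
rewrite -[leRHS]mul1r ler_pdivlMr //.
suff -> : (\sum_(s < m) r ^+ s) * (1 - r) = 1 - r ^+ m.
  by rewrite lerBlDr lerDl exprn_ge0.
elim: m => [|m IH]; first by rewrite big_ord0 mul0r subrr.
by rewrite big_ord_recr /= mulrDl IH exprS; ring.
Qed.

(** The left-hand side is a single term of the expansion of (1 + s / n) ^ n. *)
Lemma binomial_exp_le (n s : nat) : (0 < n)%N -> (s <= n)%N ->
  'C(n, s)%:R * (s%:R / n%:R) ^+ s <= expR s%:R :> R.
Proof.
move=> n0 sn.
apply: (@le_trans _ _ ((1 + s%:R / n%:R) ^+ n)).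
  rewrite exprDn (bigD1 (Ordinal (sn : (s < n.+1)%N))) //=.
  rewrite expr1n mul1r [leLHS]mulr_natl lerDl; apply: sumr_ge0 => i _.
  by rewrite expr1n mul1r mulrn_wge0 ?exprn_ge0 ?divr_ge0 ?ler0n.
have -> : expR s%:R = expR (s%:R / n%:R) ^+ n :> R.
  by rewrite -expRM_natl mulrC divfK // pnatr_eq0 -lt0n.
by apply: lerXn2r (expR_ge1Dx _); rewrite nnegrE ?expR_ge0 // addr_ge0 ?divr_ge0.
Qed.

(** The share of a set of s elements in a union bound over all subsets of an
    n-set: up to the exponential it is the inverse of the bound (e n / s) ^ s on
    the number of such sets, so that the shares of all subsets add up to O(1). *)
Definition subset_weight (n s : nat) : R :=
  (s%:R / n%:R) ^+ s * expR (- (2 * s%:R)).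

Lemma sum_subset_weight_le (I : finType) : (0 < #|I|)%N ->
  \sum_(S : {set I}) subset_weight #|I| #|S| <= 2.
Proof.
move=> n0; set n := #|I|.
have Sn (S : {set I}) : (#|S| < n.+1)%N by rewrite ltnS max_card.
rewrite (partition_big (fun S => Ordinal (Sn S)) xpredT) //=.
apply: (@le_trans _ _ (\sum_(s < n.+1) (expR (- 1)) ^+ s)).
  apply: ler_sum => s _.
  rewrite (eq_bigr (fun=> subset_weight n s)); last by move=> S /eqP <-.
  rewrite sumr_const.
  have -> : #|[pred S : {set I} | Ordinal (Sn S) == s]| = 'C(n, s).
    rewrite -card_draws cardsE; apply: eq_card => S; rewrite !inE.
    by rewrite -(inj_eq val_inj).
  rewrite -mulr_natl /subset_weight mulrA.
  apply: (@le_trans _ _ (expR s%:R * expR (- (2 * s%:R)))).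
    by rewrite ler_wpM2r ?expR_ge0 // binomial_exp_le // -ltnS.
  by rewrite -expRD -expRM_natl ler_expR; lra.
have := @expRN1_le R; have := expR_gt0 (- 1 : R) => e0 e1.
apply: (le_trans (sum_geometric_le _ _)); first by apply/andP; split; lra.
by rewrite invf_ple ?posrE //; lra.
Qed.

End Counting.


Lemma sum_pairs (R : nmodType) (I J : finType) (F : I * J -> R) :
  \sum_e F e = \sum_i \sum_j F (i, j).
Proof. by rewrite pair_bigA; apply: eq_bigr => -[]. Qed.

Lemma natr_card (R : pzSemiRingType) (I : finType) (S : {set I}) :
  #|S|%:R = \sum_i (i \in S)%:R :> R.
Proof.
by rewrite -sum1_card natr_sum big_mkcond; apply: eq_bigr => i _; case: (i \in S).
Qed.

(** * Tail bounds for the random graph at a fixed p *)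

Section RandomGraphTails.
Context (R : realType) (n : nat) (p : R).
Hypotheses (p0 : 0 <= p) (p1 : p <= 1).

Local Notation edge := ('I_n * 'I_n)%type.

(** A graph is a set of pairs; only the pairs with increasing entries can be
    edges, the other ones are given probability 0. *)
Definition edge_prob (e : edge) : R := if (e.1 < e.2)%N then p else 0.

Lemma edge_prob01 e : 0 <= edge_prob e <= 1.
Proof. by rewrite /edge_prob; case: ifP; rewrite ?p0 ?p1 ?lexx ?ler01. Qed.

Definition centered (G : {set edge}) (e : edge) : R := (e \in G)%:R - edge_prob e.

Definition star (i : 'I_n) (e : edge) : R := (e.1 == i)%:R + (e.2 == i)%:R.

Definition degree (G : {set edge}) (i : 'I_n) : R := \sum_(e in G) star i e.

Lemma star_sum (F : edge -> R) i :
  \sum_e F e * star i e = \sum_j (F (i, j) + F (j, i)).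
Proof.
rewrite big_split /=; under eq_bigr do rewrite mulrDr.
rewrite big_split /=; congr (_ + _).
  rewrite sum_pairs /=.
  rewrite (bigD1 i) //= [X in _ + X]big1 ?addr0 => [|a ai].
    by apply: eq_bigr => j _; rewrite eqxx mulr1.
  by rewrite big1 // => b _; rewrite (negbTE ai) mulr0.
rewrite sum_pairs /=.
apply: eq_bigr => a _; rewrite (bigD1 i) //= [X in _ + X]big1 ?addr0 => [|b bi].
  by rewrite eqxx mulr1.
by rewrite (negbTE bi) mulr0.
Qed.

Lemma expected_degree i : \sum_e edge_prob e * star i e = n%:R * p - p.
Proof.
rewrite star_sum (bigD1 i) //= /edge_prob /= ltnn addr0 add0r.
under eq_bigr => j ji.
  rewrite (_ : _ + _ = p); last first.
    by case: ltngtP => h; rewrite ?addr0 ?add0r //; move/val_inj: h ji => ->; rewrite eqxx.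
  over.
rewrite sumr_const cardC1 card_ord -mulr_natl -[in RHS](ltn_predK (ltn_ord i)).
by rewrite -natr1; ring.
Qed.

(** A negative theta gives the lower tail. *)
Lemma degree_tail (theta t : R) i :
  bernoulli_pr edge_prob (fun G => theta * t <= theta * degree G i) <=
  expR ((n%:R * p - p) * (expR theta - 1) - theta * t).
Proof.
have := chernoff edge_prob01 (fun e => theta * star i e) (theta * t).
have -> : \sum_e edge_prob e * (expR (theta * star i e) - 1) =
   (n%:R * p - p) * (expR theta - 1).
  rewrite -(expected_degree i) mulr_suml; apply: eq_bigr => e _.
  rewrite /edge_prob /star; case: ifP => [lt|]; last by rewrite !mul0r.
  have ne : (e.1 == i) && (e.2 == i) = false.
    by apply/negP => /andP[/eqP h1 /eqP h2]; rewrite h1 h2 ltnn in lt.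
  move: ne; case: (e.1 == i); case: (e.2 == i) => //= _;
    by rewrite ?addr0 ?add0r ?mulr0 ?mulr1 ?expR0 ?subrr ?mul0r ?mulr0 ?mulr1.
apply: le_trans; apply: bernoulli_pr_mono; first exact: edge_prob01.
by move=> G; rewrite /degree mulr_sumr.
Qed.

Definition cut (G : {set edge}) (S T : {set 'I_n}) : R :=
  \sum_(i in S) \sum_(j in T) centered G (i, j).

(** The function psi is left free: theta ^ 2 is the Gaussian choice, and
    exp theta - 1 the Poisson one. *)
Lemma cut_tail (S T : {set 'I_n}) (theta psi tau : R) : 0 <= theta ->
  expR theta - 1 - theta <= psi -> expR (- theta) - 1 + theta <= psi ->
  bernoulli_pr edge_prob (fun G => tau <= `|cut G S T|) <=
  2 * expR (p * (#|S|%:R * #|T|%:R) * psi - theta * tau).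
Proof.
move=> th0 psi1 psi2.
have psi0 : 0 <= psi.
  by apply: le_trans psi1; have := expR_ge1Dx theta; lra.
pose chi (e : edge) : R := (e.1 \in S)%:R * (e.2 \in T)%:R.
have cutE G : cut G S T = \sum_e chi e * centered G e.
  rewrite sum_pairs /cut.
  rewrite big_mkcond /=; apply: eq_bigr => i _; rewrite /chi /=.
  case: (i \in S); last by rewrite big1 // => j _; rewrite !mul0r.
  rewrite big_mkcond /=; apply: eq_bigr => j _.
  by case: (j \in T); rewrite ?mul1r ?mul0r // mulr0 mul0r.
have chi_sum : \sum_e edge_prob e * chi e <= p * (#|S|%:R * #|T|%:R).
  have -> : #|S|%:R * #|T|%:R = \sum_e chi e.
    rewrite sum_pairs /chi /=.
    under [RHS]eq_bigr do rewrite -mulr_sumr.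
    by rewrite -mulr_suml !natr_card.
  rewrite mulr_sumr; apply: ler_sum => e _; rewrite ler_wpM2r ?mulr_ge0 //.
  by rewrite /edge_prob; case: ifP.
have tail (b : bool) : bernoulli_pr edge_prob
    (fun G => theta * tau <= \sum_e ((-1) ^+ b * theta * chi e) * centered G e) <=
    expR (p * (#|S|%:R * #|T|%:R) * psi - theta * tau).
  apply: (le_trans (chernoff_centered edge_prob01 _ _)).
  rewrite ler_expR lerB //.
  apply: (@le_trans _ _ (\sum_e edge_prob e * chi e * psi)).
    apply: ler_sum => e _; rewrite -[leRHS]mulrA ler_wpM2l //.
      by case/andP: (edge_prob01 e).
    have [->|->] : chi e = 0 \/ chi e = 1.
        by rewrite /chi; case: (e.1 \in S); case: (e.2 \in T); rewrite ?mul0r ?mulr0 ?mulr1; auto.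
      by rewrite !mulr0 mul0r expR0 subrr subr0.
    by rewrite mulr1 mul1r mulr_sign; case: (b); rewrite ?opprK.
  by rewrite -mulr_suml ler_wpM2r.
rewrite mulr2n mulrDl mul1r; apply: (le_trans _ (lerD (tail false) (tail true))).
apply: (le_trans (bernoulli_pr_union edge_prob01 (K := bool) (C := xpredT)
  (Q' := fun b G => theta * tau <=
      \sum_e ((-1) ^+ b * theta * chi e) * centered G e) _)).
  move=> G; rewrite ler_normr cutE => /orP[h|h].
    exists false => //; rewrite expr0 mul1r.
    under eq_bigr do rewrite -mulrA.
    by rewrite -mulr_sumr ler_wpM2l.
  exists true => //; rewrite expr1.
  under eq_bigr do rewrite -mulrA mulN1r mulNr -mulrN.
  rewrite -mulr_sumr; apply: ler_wpM2l => //.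
  by rewrite sumrN.
by rewrite big_bool addrC.
Qed.

End RandomGraphTails.

Section DegreeVector.
Context (R : realType) (n : nat) (p : R).
Hypotheses (p0 : 0 <= p) (p1 : p <= 1).
Local Notation edge := ('I_n * 'I_n)%type.

Definition centered_degree (G : {set edge}) (i : 'I_n) : R :=
  \sum_e star R i e * centered p G e.

Lemma centered_degreeE G i :
  centered_degree G i = degree R G i - (n%:R * p - p).
Proof.
rewrite -(expected_degree p i) /degree [X in X - _]big_mkcond /= -sumrB.
apply: eq_bigr => e _; rewrite mulrBr [star _ _ _ * edge_prob _ _]mulrC.
by case: (e \in G); rewrite ?mulr1 ?mulr0.
Qed.

Lemma sum_star_endpoints (a : 'I_n -> R) (e : edge) :
  \sum_i a i * star R i e = a e.1 + a e.2.
Proof.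
rewrite /star; under eq_bigr do rewrite mulrDr.
rewrite big_split /= (bigD1 e.1) //= eqxx mulr1 big1 ?addr0; last first.
  by move=> i ne; rewrite eq_sym (negbTE ne) mulr0.
rewrite (bigD1 e.2) //= eqxx mulr1 big1 ?addr0 //.
by move=> i ne; rewrite eq_sym (negbTE ne) mulr0.
Qed.

(** A linear form in the degrees is a linear form in the edges, in which the edge
    (i, j) has coefficient a i + a j; this avoids any discussion of the dependence
    between degrees. *)
Lemma degree_vector_tail (a : 'I_n -> R) (t : R) : (forall i, `|a i| <= 1 / 2) ->
  bernoulli_pr (edge_prob p) (fun G => t <= \sum_i a i * centered_degree G i) <=
  expR (2 * (n%:R * p) * (\sum_i a i ^+ 2) - t).
Proof.
move=> a12.
pose c (e : edge) := a e.1 + a e.2.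
have cE (e : edge) : c e = \sum_i a i * star R i e by rewrite sum_star_endpoints.
have := chernoff_centered (edge_prob01 p0 p1) c t.
have var : \sum_e edge_prob p e * (expR (c e) - 1 - c e) <=
    2 * (n%:R * p) * (\sum_i a i ^+ 2).
  apply: (@le_trans _ _ (\sum_e edge_prob p e *
      (2 * \sum_i a i ^+ 2 * star R i e))).
    apply: ler_sum => e _; have /andP[f0 _] := edge_prob01 p0 p1 e.
    apply: ler_wpM2l => //.
    have h1 := a12 e.1; have h2 := a12 e.2.
    move: h1 h2; rewrite !ler_norml => /andP[h1 h2] /andP[h3 h4].
    apply: (le_trans (expR_le_sqr _)); first by rewrite /c; lra.
    rewrite (sum_star_endpoints (fun i => a i ^+ 2)) /c; have := sqr_ge0 (a e.1 - a e.2); rewrite sqrrB sqrrD; lra.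
  under eq_bigr do rewrite mulrCA mulr_sumr.
  rewrite -mulr_sumr exchange_big -mulrA /=; apply: ler_wpM2l => //.
  rewrite mulr_sumr; apply: ler_sum => i _.
  under eq_bigr do rewrite mulrCA.
  rewrite -mulr_sumr expected_degree mulrC; apply: ler_wpM2r; first exact: sqr_ge0.
  by rewrite gerBl.
move=> h; apply: (@le_trans _ _ (expR (\sum_e edge_prob p e * (expR (c e) - 1 - c e) - t))).
  apply: le_trans h; apply: bernoulli_pr_mono; first exact: edge_prob01.
  move=> G; congr (_ <= _); under eq_bigr do rewrite /centered_degree mulr_sumr.
  rewrite exchange_big /=; apply: eq_bigr => e _.
  by rewrite cE mulr_suml; apply: eq_bigr => i _; rewrite mulrA.
by rewrite ler_expR lerB.
Qed.

Context (K : nat) (h : R).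
Hypotheses (h0 : 0 < h) (Kh : K%:R <= 4 * h) (ph : n%:R * p <= 2 * h ^+ 2).

(** The degree deviations, rounded towards 0 in units of h and recorded by a sign
    and an integer, have a large sum of squares.  The finite range of the integers
    is harmless since it will cover all deviations allowed by the maximal
    degree. *)
Definition spread_degrees (G : {set edge}) : bool :=
  [exists k : {ffun 'I_n -> bool * 'I_K.+1},
    (256 * n%:R <= \sum_i ((k i).2%:R : R) ^+ 2) &&
    [forall i, (k i).2%:R * h <= (-1) ^+ (k i).1 * centered_degree G i]].

Lemma sum_expN_le (m : nat) : \sum_(s < m) expR (- (s%:R ^+ 2 / 32)) <= 33 :> R.
Proof.
set r := expR (- (1 / 32)) : R.
have r1 : r <= 32 / 33.
  rewrite /r expRN -[leRHS]invrK lef_pV2 ?posrE ?expR_gt0 ?invf_div ?divr_gt0 //.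
  by apply: (le_trans _ (expR_ge1Dx _)); lra.
have r0 : 0 < r by exact: expR_gt0.
apply: (@le_trans _ _ (\sum_(s < m) r ^+ s)).
  apply: ler_sum => s _; rewrite /r -expRM_natl ler_expR.
  have : (s%:R : R) <= s%:R ^+ 2.
    by rewrite -natrX ler_nat -mulnn; case: (nat_of_ord s) => // x; exact: leq_pmulr.
  lra.
apply: (le_trans (sum_geometric_le _ _)); first by apply/andP; split; lra.
by rewrite invf_ple ?posrE //; lra.
Qed.

(** For a given integer vector m the linear form with coefficients m_i / (8 h) has
    tail exp (- |m| ^ 2 / 16).  One half of the exponent is spent on the factor
    exp (- 8 n), the other one makes the sum over all vectors converge to at most
    66 ^ n <= exp (6 n). *)
Lemma spread_degrees_tail :
  bernoulli_pr (edge_prob p) spread_degrees <= expR (- (2 * n%:R)).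
Proof.
pose m (k : {ffun 'I_n -> bool * 'I_K.+1}) i : R := (k i).2%:R.
apply: (le_trans (bernoulli_pr_union (edge_prob01 p0 p1)
  (C := fun k : {ffun 'I_n -> bool * 'I_K.+1} => 256 * n%:R <= \sum_i m k i ^+ 2)
  (Q' := fun k G => (\sum_i m k i ^+ 2) / 8 <=
     \sum_i ((-1) ^+ (k i).1 * m k i / (8 * h)) * centered_degree G i) _)).
  move=> G /existsP[k /andP[k1 /forallP k2]]; exists k => //.
  rewrite mulr_suml; apply: ler_sum => i _.
  have := k2 i; rewrite -/(m k i); set D := centered_degree G i => hD.
  have -> : (-1) ^+ (k i).1 * m k i / (8 * h) * D =
     m k i / (8 * h) * ((-1) ^+ (k i).1 * D) by ring.
  have m0 : 0 <= m k i by exact: ler0n.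
  apply: (@le_trans _ _ (m k i / (8 * h) * (m k i * h))).
    by rewrite le_eqVlt; apply/orP; left; apply/eqP; field; rewrite lt0r_neq0.
  by apply: ler_wpM2l => //; rewrite divr_ge0 // mulr_ge0 // ltW.
apply: (@le_trans _ _ (\sum_(k : {ffun 'I_n -> bool * 'I_K.+1})
    expR (- (8 * n%:R)) * \prod_i expR (- (m k i ^+ 2 / 32)))).
  rewrite big_mkcond /=; apply: ler_sum => k _.
  case: ifPn => [k1|_]; last first.
    by rewrite mulr_ge0 ?expR_ge0 ?prodr_ge0 // => i _; rewrite expR_ge0.
  apply: (le_trans (degree_vector_tail _ _)) => [i|].
    rewrite normrM normrM normrX normrN1 expr1n mul1r ger0_norm ?ler0n //.
    rewrite gtr0_norm ?invr_gt0 ?mulr_gt0 // ler_pdivrMr ?mulr_gt0 //.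
    have : m k i <= K%:R by rewrite /m ler_nat -ltnS.
    by move=> hm; have := le_trans hm Kh; move: (m k i) => a; lra.
  rewrite -expR_sum -expRD ler_expR sumrN -mulr_suml.
  have -> : \sum_i ((-1) ^+ (k i).1 * m k i / (8 * h)) ^+ 2 =
     (\sum_i m k i ^+ 2) / (64 * h ^+ 2).
    rewrite mulr_suml; apply: eq_bigr => i _.
    rewrite !exprMn sqrr_sign mul1r exprVn exprMn; congr (_ / (_ * _)); ring.
  move: k1; set V := \sum_i _ => k1.
  have V0 : 0 <= V by apply: sumr_ge0 => i _; exact: sqr_ge0.
  have : 2 * (n%:R * p) * (V / (64 * h ^+ 2)) <= V / 16.
    have h2 : 0 < h ^+ 2 by rewrite exprn_gt0.
    have aux (a b c : R) : 0 <= a -> c <= 2 * b -> 2 * c * a <= a / 16 * (64 * b) by nra.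
    by rewrite mulrA ler_pdivrMr ?mulr_gt0 //; exact: aux.
  lra.
rewrite -mulr_sumr -(bigA_distr_bigA (fun i (x : bool * 'I_K.+1) =>
   expR (- ((x.2%:R : R) ^+ 2 / 32)))) /=.
rewrite big_const cardT size_enum_ord.
apply: (@le_trans _ _ (expR (- (8 * n%:R)) * 66 ^+ n)).
  rewrite ler_wpM2l ?expR_ge0 // -Monoid.iteropE /=.
  rewrite sum_pairs big_bool /=.
  have S0 : 0 <= \sum_(s < K.+1) expR (- (s%:R ^+ 2 / 32)) :> R.
    by apply: sumr_ge0 => s _; exact: expR_ge0.
  apply: lerXn2r; rewrite ?nnegrE ?addr_ge0 //.
  have := sum_expN_le K.+1; lra.
have e6 : 66 <= expR 6 :> R.
  have -> : 6 = 6%:R * 1 :> R by rewrite mulr1.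
  rewrite expRM_natl; have := @expR1_ge R => e1.
  by apply: (le_trans _ (lerXn2r 6 _ _ e1)); rewrite ?nnegrE ?expR_ge0 //; lra.
apply: (@le_trans _ _ (expR (- (8 * n%:R)) * expR 6 ^+ n)).
  by rewrite ler_wpM2l ?expR_ge0 //; apply: lerXn2r; rewrite ?nnegrE ?expR_ge0.
by rewrite -expRM_natl -expRD ler_expR; lra.
Qed.

End DegreeVector.

(** * The typical graph at a fixed p *)

(** The numerical comparison of exponents for large sets: b stands for d m with m
    the number of vertices, e for the entropy of all pairs of sets. *)
Lemma gaussian_exponent_le (R : realType) (d m a b e l : R) :
  4 * 10 ^+ 6 <= d -> 2 * d <= m -> l <= 3 / 4 ->
  a <= 2 * b -> 4 * 10 ^+ 6 * m <= b -> e <= m * (3 / 2) ->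
  l + (a / 1000 / 1000 / 256 - b / 1000 / 1600) <= - (d / 50) - e.
Proof.
move=> H1 H2 H3 H4 H5 H6.
have m0 : 0 <= m by apply: le_trans H2; apply: mulr_ge0 => //; lra.
have H : m * (12 / 5) <= b / 1000 / 1600 - b / 1000 / 1000 / 128 by lra.
have H7 : a / 1000 / 1000 / 256 <= b / 1000 / 1000 / 128 by lra.
have H8 : l <= m / 100 by lra.
have H9 : d / 50 <= m / 100 by lra.
move: (a / _ / _ / _) (b / _ / _ / _) (b / _ / _) (d / 50) H H7 H8 H9 => *; lra.
Qed.

Section TypicalGraph.
Context (R : realType) (n : nat) (p d : R).
Hypotheses (p0 : 0 <= p) (p1 : p <= 1) (n0 : (0 < n)%N).
Hypotheses (d_le_np : d <= n%:R * p) (np_le_2d : n%:R * p <= 2 * d).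
Hypotheses (d_le_n : 2 * d <= n%:R) (d_large : 4 * 10 ^+ 6 <= d)
  (n_le_exp : n%:R <= expR (d / 4)).
Local Notation edge := ('I_n * 'I_n)%type.

Let nR : 0 < n%:R :> R. Proof. by rewrite ltr0n. Qed.

(** Outside this range the bounds of the cut by degrees, 4 d |S| and 4 d |T|, are
    already below d sqrt(|S| |T|) / 80, since 4 * 80 = 320. *)
Definition balanced (S T : {set 'I_n}) : bool :=
  (#|S|%:R < 320 ^+ 2 * #|T|%:R :> R) && (#|T|%:R < 320 ^+ 2 * #|S|%:R :> R).

(** Large sets: the tail beats the number 4 ^ n of all pairs of sets.  The choice
    theta = n / (c sg) is proportional to the optimal one and stays below 1. *)
Let cut_gaussian (s t sg c : R) : 0 < sg -> sg ^+ 2 = s * t ->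
  c = 16 * 1000 -> n%:R <= c * sg ->
  exists2 theta, 0 <= theta <= 1 &
  2 * expR (p * (s * t) * theta ^+ 2 - theta * (d * sg / 100)) <=
  expR (- (d / 50)) * (4 ^+ n)^-1.
Proof.
move=> sg0 st cE nsg.
have c0 : 0 < c by rewrite cE; lra.
have csg0 : 0 < c * sg by rewrite mulr_gt0.
exists (n%:R / (c * sg)).
  by rewrite divr_ge0 ?(ltW csg0) //= ler_pdivrMr // mul1r.
have -> : (4 ^+ n)^-1 = expR (- (n%:R * ln 4)) :> R.
  by rewrite expRN expRM_natl lnK ?posrE.
have -> : 2 = expR (ln 2) :> R by rewrite lnK ?posrE.
rewrite -!expRD ler_expR -st.
have -> : p * sg ^+ 2 * (n%:R / (c * sg)) ^+ 2 = n%:R * p * n%:R / c ^+ 2.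
  by field; rewrite !lt0r_neq0.
have -> : n%:R / (c * sg) * (d * sg / 100) = n%:R * d / (c * 100).
  by field; rewrite !lt0r_neq0.
have l2 := @ln2_le R.
have -> : ln 4 = 2 * ln 2 :> R.
  have -> : 4 = 2 * 2 :> R by lra.
  by rewrite lnM ?posrE // mulr2n mulrDl mul1r.
have h1 : n%:R * p * n%:R <= 2 * d * n%:R by rewrite ler_wpM2r.
have h2 : 4 * 10 ^+ 6 * n%:R <= d * n%:R by rewrite ler_wpM2r.
have h3 : n%:R * (2 * ln 2) <= n%:R * (3 / 2) :> R.
  by apply: ler_wpM2l => //; lra.
have h4 : 2 * d * n%:R = 2 * (d * n%:R) by ring.
rewrite h4 in h1; rewrite [n%:R * d]mulrC.
move: (n%:R * p * n%:R) (d * n%:R) (n%:R * (2 * ln 2)) h1 h2 h3 => a b e h1 h2 h3.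
move: (ln 2) l2 => l l2; 
have -> : a / c ^+ 2 = a / 1000 / 1000 / 256 by rewrite cE; field.
have -> : b / (c * 100) = b / 1000 / 1600 by rewrite cE; field.
exact: (gaussian_exponent_le d_large d_le_n l2 h1 h2 h3).
Qed.


(** Small sets: theta is essentially the logarithm of the ratio of the deviation to
    the mean.
    Four fifths of the exponent give exp (- d / 50), and one fifth pays for the
    number of sets, whose logarithm also grows linearly in theta.  The constants c
    and b are variables, with their values as hypotheses, to keep these numerals
    from being unfolded. *)
Let cut_poisson (s t : nat) (sg c b : R) : (0 < s)%N -> (0 < t)%N ->
  0 < sg -> sg ^+ 2 = s%:R * t%:R ->
  c = 16 * 1000 -> c * sg < n%:R -> b = 320 ->
  s%:R <= b * sg -> t%:R <= b * sg -> sg <= b * s%:R -> sg <= b * t%:R ->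
  exists2 theta, 0 <= theta &
  2 * expR (p * (s%:R * t%:R) * (expR theta - 1) - theta * (d * sg / 100)) <=
  expR (- (d / 50)) * (subset_weight R n s * subset_weight R n t).
Proof.
move=> s0 t0 sg0 st cE csg bE sb tb bs bt.
have c0 : 0 < c by rewrite cE; lra.
pose x := n%:R / (c / 40 * sg).
have x40 : 40 < x.
  rewrite /x ltr_pdivlMr ?mulr_gt0 ?divr_gt0 //; move: csg; lra.
pose theta := ln (1 + x); exists theta.
  by rewrite ln_ge0 //; lra.
have eth : expR theta = 1 + x by rewrite lnK // posrE; lra.
have th3 : 3 <= theta.
  rewrite -ler_expR eth.
  have -> : 3 = 3%:R * 1 :> R by rewrite mulr1.
  rewrite expRM_natl; apply: (@le_trans _ _ (3 ^+ 3)); last by move: x40; lra.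
  by apply: lerXn2r; rewrite ?nnegrE ?expR_ge0 // expR1_le3.
have weight (r : nat) : (0 < r)%N -> sg <= b * r%:R ->
    expR (- (r%:R * (17 + theta))) <= subset_weight R n r.
  move=> r0 br; have rR : 0 < r%:R :> R by rewrite ltr0n.
  have hn : n%:R / r%:R <= expR (15 + theta).
    rewrite ler_pdivrMr // expRD eth.
    have nx : n%:R = x * (c / 40 * sg).
      by rewrite /x divfK // lt0r_neq0 // mulr_gt0 ?divr_gt0.
    have e15 : b * (c / 40) <= expR 15.
      have -> : 15 = 15%:R * 1 :> R by rewrite mulr1.
      rewrite expRM_natl; apply: (@le_trans _ _ ((9 / 4) ^+ 15)).
        by rewrite bE cE; lra.
      by apply: lerXn2r; rewrite ?nnegrE ?expR_ge0 ?divr_ge0 // expR1_ge.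
    rewrite nx; apply: (@le_trans _ _ (x * (c / 40 * (b * r%:R)))).
      rewrite ler_wpM2l //; first lra.
      by rewrite ler_wpM2l // divr_ge0 // ltW.
    have -> : x * (c / 40 * (b * r%:R)) = b * (c / 40) * x * r%:R by ring.
    apply: ler_wpM2r; first exact: ltW.
    have b0 : 0 <= b by rewrite bE ler0n.
    apply: ler_pM => //; last by rewrite lerDr.
      by rewrite mulr_ge0 ?divr_ge0 ?(ltW c0).
    by apply: le_trans (ltW x40).
  rewrite /subset_weight -[r%:R / n%:R]invf_div.
  have -> : - (r%:R * (17 + theta)) = r%:R * (- (15 + theta)) + - (2 * r%:R) by ring.
  rewrite expRD ler_pM2r ?expR_gt0 // expRM_natl.
  apply: lerXn2r; rewrite ?nnegrE ?expR_ge0 ?invr_ge0 ?divr_ge0 // expRN.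
  by rewrite lef_pV2 ?posrE ?expR_gt0 ?divr_gt0.
apply: (@le_trans _ _ (expR (- (d / 50)) *
    (expR (- (s%:R * (17 + theta))) * expR (- (t%:R * (17 + theta)))))); last first.
  by rewrite ler_wpM2l ?expR_ge0 // ler_pM ?expR_ge0 // weight.
rewrite -!expRD.
apply: (@le_trans _ _ (expR (1 + (p * (s%:R * t%:R) * (expR theta - 1) - theta * (d * sg / 100))))).
  rewrite [leRHS]expRD; apply: ler_wpM2r; first exact: expR_ge0.
  by have := expR_ge1Dx (1 : R); lra.
rewrite ler_expR eth -st.
have -> : p * sg ^+ 2 * (1 + x - 1) = (n%:R * p) * sg / (c / 40).
  by rewrite /x; field; rewrite !lt0r_neq0.
have sR : 1 <= s%:R :> R by rewrite ler1n.
have tR : 1 <= t%:R :> R by rewrite ler1n.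
have sg1 : 1 <= sg.
  by rewrite -(ler_pXn2r (ltn0Sn 1)) ?nnegrE ?(ltW sg0) // expr1n st mulr_ege1.
have h1 : (n%:R * p) * sg / (c / 40) <= d * sg / 200.
  have -> : d * sg / 200 = 2 * d * sg / 400 by field.
  have -> : c / 40 = 400 by rewrite cE; lra.
  by rewrite ler_pM2r ?invr_gt0 ?ltr0n // ler_pM2r.
have d0 : 0 < d by have := d_large; lra.
have big : d * (theta - 1 / 2) * sg >= 4 * 10 ^+ 6 * (theta - 1 / 2) * sg.
  by rewrite ler_wpM2r ?(ltW sg0) // ler_wpM2r //; lra.
have big' : (theta - 1 / 2) * ((s%:R + t%:R) / 640) <= (theta - 1 / 2) * sg.
  by rewrite ler_wpM2l //; [|move: sb tb; rewrite bE]; lra.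
have big2 : d * (5 / 2) <= d * (theta - 1 / 2) * sg.
  rewrite -mulrA ler_wpM2l ?(ltW d0) //.
  by apply: (@le_trans _ _ ((theta - 1 / 2) * 1)); [|rewrite ler_wpM2l //]; lra.
have ths : 3 * (s%:R + t%:R) <= theta * (s%:R + t%:R) by rewrite ler_wpM2r //; lra.
have -> : theta * (d * sg / 100) = (d * (theta - 1 / 2) * sg) / 100 + d * sg / 200 by field.
move: big big' big2 ths h1; set y := d * (theta - 1 / 2) * sg.
set z := (n%:R * p) * sg / (c / 40); set w := d * sg / 200.
rewrite -[4 * 10 ^+ 6 * _ * sg]mulrA; set v := (theta - 1 / 2) * sg.
move: (s%:R : R) (t%:R : R) sR tR => s' t' sR tR.
have -> : (theta - 1 / 2) * ((s' + t') / 640) = theta * (s' + t') / 640 - (s' + t') / 1280 by field.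
have -> : - (s' * (17 + theta)) - t' * (17 + theta) = - 17 * (s' + t') - theta * (s' + t') by ring.
move: (theta * (s' + t')) y z w v => u y z w v h1 h2 h3 h4 h5.
lra.
Qed.

Lemma balanced_cut_tail (S T : {set 'I_n}) : balanced S T ->
  bernoulli_pr (edge_prob p)
    (fun G => d * Num.sqrt (#|S|%:R * #|T|%:R) / 100 <= `|cut p G S T|) <=
  expR (- (d / 50)) *
    ((4 ^+ n)^-1 + subset_weight R n #|S| * subset_weight R n #|T|).
Proof.
rewrite /balanced => /andP[sT tS].
have posT : (0 < #|T|)%N.
  by rewrite lt0n; apply: contraTN sT => /eqP ->; rewrite mulr0 -leNgt.
have posS : (0 < #|S|)%N.
  by rewrite lt0n; apply: contraTN tS => /eqP ->; rewrite mulr0 -leNgt.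
have w0 (r : nat) : 0 <= subset_weight R n r.
  by rewrite mulr_ge0 ?expR_ge0 // exprn_ge0 // divr_ge0.
set s : R := #|S|%:R in sT tS *; set t : R := #|T|%:R in sT tS *.
have s0 : 0 < s by rewrite /s ltr0n.
have t0 : 0 < t by rewrite /t ltr0n.
set sg := Num.sqrt (s * t).
have sg0 : 0 < sg by rewrite sqrtr_gt0 mulr_gt0.
have sg2 : sg ^+ 2 = s * t by rewrite sqr_sqrtr // mulr_ge0 ?ltW.
have [c cE] : exists c : R, c = 16 * 1000 by exists (16 * 1000).
have [b bE] : exists b : R, b = 320 by exists 320.
have b0 : 0 < b by rewrite bE ltr0n.
rewrite -bE in sT tS.
have root_le (x y : R) : 0 < x -> 0 < y -> x < b ^+ 2 * y -> x <= b * Num.sqrt (x * y).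
  move=> x0 y0 xy; rewrite -(@ler_pXn2r _ 2) ?nnegrE ?(ltW x0) //; last first.
    by rewrite mulr_ge0 ?sqrtr_ge0 ?ltW.
  rewrite exprMn sqr_sqrtr ?mulr_ge0 ?(ltW x0) ?(ltW y0) // mulrCA expr2.
  by rewrite ler_pM2l // ltW.
have le_root (x y : R) : 0 < x -> 0 < y -> y < b ^+ 2 * x -> Num.sqrt (x * y) <= b * x.
  move=> x0 y0 xy; rewrite -(@ler_pXn2r _ 2) ?nnegrE ?sqrtr_ge0 //; last first.
    by rewrite mulr_ge0 ?ltW.
  rewrite exprMn sqr_sqrtr ?mulr_ge0 ?(ltW x0) ?(ltW y0) // expr2 mulrCA.
  by rewrite ler_pM2l // ltW // mulrC.
have [nsg|nsg] := leP n%:R (c * sg).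
  have [theta /andP[th0 th1] tail] := cut_gaussian sg0 sg2 cE nsg.
  apply: (le_trans (@cut_tail R n p p0 p1 S T theta (theta ^+ 2) _ th0 _ _)).
  - exact: expR_le_sqr.
  - by have := @expR_le_sqr R (- theta); rewrite sqrrN opprK; apply; lra.
  apply: (le_trans tail); rewrite mulrDr lerDl.
  by rewrite mulr_ge0 ?expR_ge0 // mulr_ge0.
have tb : t <= b * sg by rewrite /sg [s * t]mulrC; exact: root_le.
have bt : sg <= b * t by rewrite /sg [s * t]mulrC; exact: le_root.
have [theta th0 tail] := @cut_poisson #|S| #|T| sg c b posS posT sg0 sg2 cE nsg bE
  (root_le s t s0 t0 sT) tb (le_root s t s0 t0 tS) bt.
apply: (le_trans (@cut_tail R n p p0 p1 S T theta (expR theta - 1) _ th0 _ _)).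
- by rewrite lerBlDr lerDl.
- have : expR (- theta) <= 1 by rewrite expR_le1 oppr_le0.
  by have := expR_ge1Dx theta; lra.
apply: (le_trans tail); rewrite [leRHS]mulrDr lerDr.
by rewrite mulr_ge0 ?expR_ge0 // invr_ge0 exprn_ge0.
Qed.

Definition typical (h : R) (K : nat) (G : {set edge}) : bool :=
  [&& [forall i, degree R G i <= 4 * d],
      [forall i, d / 4 <= degree R G i],
      [forall S : {set 'I_n}, forall T : {set 'I_n}, balanced S T ==>
        (`|cut p G S T| <= d * Num.sqrt (#|S|%:R * #|T|%:R) / 100)] &
      ~~ spread_degrees p K h G].

(** The union bound over vertices costs n <= exp (d / 4). *)
Lemma max_degree_tail : bernoulli_pr (edge_prob p)
  (fun G : {set edge} => ~~ [forall i, degree R G i <= 4 * d]) <= expR (- (d / 50)).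
Proof.
have d0 : 0 < d by have := d_large; lra.
apply: (le_trans (bernoulli_pr_union (edge_prob01 p0 p1) (C := xpredT)
  (Q' := fun (i : 'I_n) G => 1 / 2 * (4 * d) <= 1 / 2 * degree R G i) _)).
  move=> G /forallPn[i]; rewrite -ltNge => h; exists i => //.
  by apply: ler_wpM2l => //; exact: ltW.
apply: (@le_trans _ _ (\sum_(i < n) expR (- (d / 2)))).
  apply: ler_sum => i _; apply: (le_trans (degree_tail p0 p1 _ _ _)).
  rewrite ler_expR.
  have e1 : expR (1 / 2) - 1 <= 3 / 4 :> R.
    by have := @expR_le_sqr R (1 / 2); lra.
  have e0 : 0 <= expR (1 / 2) - 1 :> R.
    by have := expR_ge1Dx (1 / 2 : R); lra.
  have : (n%:R * p - p) * (expR (1 / 2) - 1) <= 2 * d * (3 / 4).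
    have np0 : 0 <= n%:R * p - p.
      by rewrite subr_ge0 ler_peMl // ler1n.
    apply: ler_pM => //; have := np_le_2d; have := p0; lra.
  lra.
rewrite sumr_const card_ord -[_ *+ n]mulr_natl.
apply: (@le_trans _ _ (expR (d / 4) * expR (- (d / 2)))).
  by rewrite ler_wpM2r // expR_ge0.
rewrite -expRD ler_expR; lra.
Qed.

(** With theta = -1 the mean contributes (1 - exp (-1)) d > 11 / 20 d; this has to
    pay for d / 4 in the event and for d / 4 in the union bound. *)
Lemma min_degree_tail : bernoulli_pr (edge_prob p)
  (fun G : {set edge} => ~~ [forall i, d / 4 <= degree R G i]) <= expR (- (d / 50)).
Proof.
have d0 : 0 < d by have := d_large; lra.
apply: (le_trans (bernoulli_pr_union (edge_prob01 p0 p1) (C := xpredT)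
  (Q' := fun (i : 'I_n) G => - 1 * (d / 4) <= - 1 * degree R G i) _)).
  move=> G /forallPn[i]; rewrite -ltNge => h; exists i => //.
  by rewrite !mulN1r lerN2 ltW.
apply: (@le_trans _ _ (\sum_(i < n) expR (- (11 / 40 * d)))).
  apply: ler_sum => i _; apply: (le_trans (degree_tail p0 p1 _ _ _)).
  rewrite ler_expR mulN1r opprK.
  have e1 := @expRN1_le R.
  have : (n%:R * p - p) * (1 - expR (- 1)) >= (d - 1) * (5 / 9).
    by apply: ler_pM => //; have := d_le_np; have := p1; have := d_large; lra.
  have := d_large; lra.
rewrite sumr_const card_ord -[_ *+ n]mulr_natl.
apply: (@le_trans _ _ (expR (d / 4) * expR (- (11 / 40 * d)))).
  by rewrite ler_wpM2r // expR_ge0.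
rewrite -expRD ler_expR; lra.
Qed.

Lemma cut_deviation_tail : bernoulli_pr (edge_prob p)
  (fun G : {set edge} => ~~ [forall S : {set 'I_n}, forall T : {set 'I_n}, balanced S T ==>
        (`|cut p G S T| <= d * Num.sqrt (#|S|%:R * #|T|%:R) / 100)]) <=
  5 * expR (- (d / 50)).
Proof.
apply: (le_trans (bernoulli_pr_union (edge_prob01 p0 p1)
  (C := fun ST : {set 'I_n} * {set 'I_n} => balanced ST.1 ST.2)
  (Q' := fun ST G => d * Num.sqrt (#|ST.1|%:R * #|ST.2|%:R) / 100
     <= `|cut p G ST.1 ST.2|) _)).
  move=> G /forallPn[S /forallPn[T]]; rewrite negb_imply -ltNge => /andP[bST h].
  by exists (S, T) => //=; exact: ltW.
have w0 (r : nat) : 0 <= subset_weight R n r.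
  by rewrite mulr_ge0 ?expR_ge0 // exprn_ge0 // divr_ge0.
apply: (@le_trans _ _ (\sum_(ST : {set 'I_n} * {set 'I_n}) expR (- (d / 50)) *
    ((4 ^+ n)^-1 + subset_weight R n #|ST.1| * subset_weight R n #|ST.2|))).
  rewrite big_mkcond /=; apply: ler_sum => ST _; case: ifPn => [/balanced_cut_tail //|_].
  by rewrite mulr_ge0 ?expR_ge0 // addr_ge0 ?mulr_ge0 // invr_ge0 exprn_ge0.
rewrite -mulr_sumr [leRHS]mulrC ler_wpM2l ?expR_ge0 // big_split /=.
have -> : \sum_(ST : {set 'I_n} * {set 'I_n}) (4 ^+ n)^-1 = 1 :> R.
  have card_sets : #|{: {set 'I_n}}| = (2 ^ n)%N.
    by rewrite -cardsT -powersetT card_powerset cardsT card_ord.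
  rewrite sumr_const card_prod card_sets -expnMn -[_ *+ _]mulr_natl natrX.
  by apply: divff; apply: expf_neq0; rewrite pnatr_eq0.
have five (y : R) : y <= 2 * 2 -> 1 + y <= 5 by lra.
rewrite sum_pairs /=; under eq_bigr do rewrite -mulr_sumr.
rewrite -mulr_suml.
have := @sum_subset_weight_le R 'I_n; rewrite card_ord => /(_ n0) W2.
have W0 : 0 <= \sum_(S : {set 'I_n}) subset_weight R n #|S| by apply: sumr_ge0.
by apply: five; apply: ler_pM.
Qed.

Lemma atypical_tail (h : R) (K : nat) : 0 < h -> h ^+ 2 = d -> K%:R <= 4 * h ->
  bernoulli_pr (edge_prob p) (fun G : {set edge} => ~~ typical h K G) <= 8 * expR (- (d / 50)).
Proof.
move=> h0 hd Kh.
have d0 : 0 < d by have := d_large; lra.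
have spread : bernoulli_pr (edge_prob p) (@spread_degrees R n p K h) <= expR (- (d / 50)).
  have ph : n%:R * p <= 2 * h ^+ 2 by rewrite hd.
  apply: (le_trans (spread_degrees_tail p0 p1 h0 Kh ph)).
  by rewrite ler_expR; have := d_le_n; lra.
pose bad (b : 'I_4) (G : {set edge}) : bool := match val b with
  | 0%N => ~~ [forall i, degree R G i <= 4 * d]
  | 1%N => ~~ [forall i, d / 4 <= degree R G i]
  | 2%N => ~~ [forall S : {set 'I_n}, forall T : {set 'I_n}, balanced S T ==>
        (`|cut p G S T| <= d * Num.sqrt (#|S|%:R * #|T|%:R) / 100)]
  | _ => spread_degrees p K h G end.
apply: (le_trans (bernoulli_pr_union (edge_prob01 p0 p1) (C := xpredT) (Q' := bad) _)).
  move=> G; rewrite /typical !negb_and negbK => /or4P[] hG.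
  - by exists (inord 0) => //; rewrite /bad /= inordK.
  - by exists (inord 1) => //; rewrite /bad /= inordK.
  - by exists (inord 2) => //; rewrite /bad /= inordK.
  - by exists (inord 3) => //; rewrite /bad /= inordK.
rewrite !big_ord_recr big_ord0 /= add0r /bad /=.
have := max_degree_tail; have := min_degree_tail; have := cut_deviation_tail.
move: spread; lra.
Qed.

End TypicalGraph.

(** * From a grid of values of p to all values *)

Section Sandwich.
Context (R : realType) (n : nat) (a p b q d h : R) (K : nat).
Local Notation edge := ('I_n * 'I_n)%type.
Context (Gm G Gp : {set edge}).
Hypotheses (n0 : (0 < n)%N) (q0 : 0 < q) (dE : d = n%:R * q) (h0 : 0 < h)
  (hd : h ^+ 2 = d) (d_large : 4 * 10 ^+ 6 <= d) (q2 : 2 * q <= 1).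
Hypotheses (qa : q <= a) (ap : a <= p) (pb : p <= b) (b2q : b <= 2 * q)
  (ab400 : b - a <= q / 400) (nab : n%:R * (b - a) <= h) (KE : K = Num.truncn (4 * h)).
Hypotheses (GmG : Gm \subset G) (GGp : G \subset Gp)
  (upper : forall e, e \in Gp -> (e.1 < e.2)%N).
Hypotheses (typm : typical a d h K Gm) (typp : typical b d h K Gp).

Let nR : 0 < n%:R :> R. Proof. by rewrite ltr0n. Qed.
Let d0 : 0 < d. Proof. by have := d_large; lra. Qed.

Let degree_mono (G1 G2 : {set edge}) i : G1 \subset G2 -> degree R G1 i <= degree R G2 i.
Proof.
move=> /fintype.subsetP sub; rewrite /degree big_mkcond [leRHS]big_mkcond /=.
apply: ler_sum => e _; have s0 : 0 <= star R i e by rewrite addr_ge0.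
by case: ifPn => [/sub ->|_] //; case: ifP.
Qed.

Let degree_le i : degree R G i <= 4 * d.
Proof.
apply: (le_trans (degree_mono i GGp)).
by case/and4P: typp => /forallP /(_ i).
Qed.

Let degree_ge i : d / 4 <= degree R G i.
Proof.
apply: le_trans (degree_mono i GmG).
by case/and4P: typm => _ /forallP /(_ i).
Qed.

Definition edge_count (H : {set edge}) (S T : {set 'I_n}) : R :=
  \sum_(i in S) \sum_(j in T) ((i, j) \in H)%:R.

Let pairs (S T : {set 'I_n}) : R :=
  \sum_(i in S) \sum_(j in T) (i < j)%N%:R.

Let cutE r H S T : cut r H S T = edge_count H S T - r * pairs S T.
Proof.
rewrite /cut /edge_count /pairs mulr_sumr -sumrB; apply: eq_bigr => i _.
rewrite mulr_sumr -sumrB; apply: eq_bigr => j _.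
by rewrite /centered /edge_prob /=; case: ifP; rewrite ?mulr1 ?mulr0.
Qed.

Let edge_count_mono (G1 G2 : {set edge}) S T :
  G1 \subset G2 -> edge_count G1 S T <= edge_count G2 S T.
Proof.
move=> /fintype.subsetP sub; apply: ler_sum => i _; apply: ler_sum => j _.
by rewrite ler_nat; case: ((i, j) \in G1) (sub (i, j)) => // ->.
Qed.

Let pairs_ge0 S T : 0 <= pairs S T.
Proof. by apply: sumr_ge0 => i _; apply: sumr_ge0 => j _; rewrite ler0n. Qed.

Let pairs_le S T : pairs S T <= #|S|%:R * #|T|%:R.
Proof.
rewrite /pairs -natrM -sum_nat_const natr_sum; apply: ler_sum => i _.
rewrite -sum1_card natr_sum; apply: ler_sum => j _; by case: (i < j)%N.
Qed.

Let card_le (S : {set 'I_n}) : #|S|%:R <= n%:R :> R.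
Proof. by rewrite ler_nat -[leqRHS]card_ord max_card. Qed.

Let degreeE i : degree R G i = \sum_j (((i, j) \in G)%:R + ((j, i) \in G)%:R).
Proof.
rewrite -(star_sum (fun e => (e \in G)%:R)) /degree big_mkcond /=.
by apply: eq_bigr => e _; case: (e \in G); rewrite ?mul1r ?mul0r.
Qed.

Let edge_count_row S T : edge_count G S T <= 4 * d * #|S|%:R.
Proof.
rewrite mulr_natr -sumr_const; apply: ler_sum => i _.
apply: le_trans (degree_le i); rewrite degreeE [leLHS]big_mkcond /=.
apply: ler_sum => j _; case: ifP => _; last by rewrite addr_ge0.
by rewrite lerDl.
Qed.

Let edge_count_col S T : edge_count G S T <= 4 * d * #|T|%:R.
Proof.
rewrite /edge_count exchange_big mulr_natr -sumr_const; apply: ler_sum => j _.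
apply: le_trans (degree_le j); rewrite degreeE [leLHS]big_mkcond /=.
apply: ler_sum => i _; case: ifP => _; last by rewrite addr_ge0.
by rewrite lerDr.
Qed.

Let p_n : n%:R * p <= 2 * d.
Proof.
rewrite dE mulrCA ler_pM2l //; exact: le_trans pb b2q.
Qed.

Let cut_row S T : `|cut p G S T| <= 4 * d * #|S|%:R.
Proof.
have p0 : 0 <= p := le_trans (ltW q0) (le_trans qa ap).
have e0 : 0 <= edge_count G S T.
  by apply: sumr_ge0 => i _; apply: sumr_ge0 => j _; rewrite ler0n.
have h1 : p * pairs S T <= 2 * d * #|S|%:R.
  apply: (@le_trans _ _ (p * (#|S|%:R * n%:R))).
    by rewrite ler_wpM2l // (le_trans (pairs_le S T)) // ler_wpM2l.
  by rewrite mulrCA mulrC ler_wpM2r // mulrC.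
have h2 : 0 <= p * pairs S T by rewrite mulr_ge0.
have h3 : 0 <= d * #|S|%:R by rewrite mulr_ge0 // ltW.
have h4 := edge_count_row S T.
rewrite cutE ler_norml; apply/andP; split; lra.
Qed.

Let cut_col S T : `|cut p G S T| <= 4 * d * #|T|%:R.
Proof.
have p0 : 0 <= p := le_trans (ltW q0) (le_trans qa ap).
have e0 : 0 <= edge_count G S T.
  by apply: sumr_ge0 => i _; apply: sumr_ge0 => j _; rewrite ler0n.
have h1 : p * pairs S T <= 2 * d * #|T|%:R.
  apply: (@le_trans _ _ (p * (n%:R * #|T|%:R))).
    by rewrite ler_wpM2l // (le_trans (pairs_le S T)) // ler_wpM2r.
  by rewrite mulrA ler_wpM2r // mulrC.
have h2 : 0 <= p * pairs S T by rewrite mulr_ge0.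
have h3 : 0 <= d * #|T|%:R by rewrite mulr_ge0 // ltW.
have h4 := edge_count_col S T.
rewrite cutE ler_norml; apply/andP; split; lra.
Qed.

(** Balanced sets: the cut sum changes by at most (b - a) |S| |T| between the grid
    points, besides the monotone edge count.  Other sets: the degree bound. *)
Let cut_mean S T : `|cut p G S T| <= d / 80 * Num.sqrt (#|S|%:R * #|T|%:R).
Proof.
set s : R := #|S|%:R; set t : R := #|T|%:R; set sg := Num.sqrt (s * t).
have s0 : 0 <= s by exact: ler0n.
have t0 : 0 <= t by exact: ler0n.
have sg0 : 0 <= sg by exact: sqrtr_ge0.
have sg2 : sg ^+ 2 = s * t by rewrite sqr_sqrtr // mulr_ge0.
have b320 (x y : R) : 0 <= x -> 0 <= y -> 320 ^+ 2 * x <= y ->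
    320 * x <= Num.sqrt (x * y).
  move=> x0 y0 xy; rewrite -(@ler_pXn2r _ 2) ?nnegrE ?sqrtr_ge0 ?mulr_ge0 ?ler0n //.
  rewrite sqr_sqrtr ?mulr_ge0 // exprMn [x ^+ 2]expr2 mulrCA.
  by apply: ler_wpM2l.
have far (x : R) : 320 * x <= sg -> 4 * d * x <= d / 80 * sg.
  move=> hx; have := ler_wpM2l (ltW d0) hx; lra.
case bal : (balanced R S T).
  have hp : `|cut b Gp S T| <= d * sg / 100.
    by case/and4P: typp => _ _ /forallP /(_ S) /forallP /(_ T); rewrite bal.
  have hm : `|cut a Gm S T| <= d * sg / 100.
    by case/and4P: typm => _ _ /forallP /(_ S) /forallP /(_ T); rewrite bal.
  have := edge_count_mono S T GGp; have := edge_count_mono S T GmG.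
  have hw : (b - a) * pairs S T <= d * sg / 400.
    apply: (@le_trans _ _ (q / 400 * (sg * n%:R))); last by rewrite dE; lra.
    apply: ler_pM => //; first by rewrite subr_ge0 (le_trans ap).
    apply: (le_trans (pairs_le S T)); rewrite -/s -/t -sg2 expr2 ler_wpM2l //.
    rewrite -(@ler_pXn2r _ 2) ?nnegrE ?ler0n // sg2 expr2.
    by apply: ler_pM => //; exact: card_le.
  have w1 : 0 <= (b - p) * pairs S T by rewrite mulr_ge0 // subr_ge0.
  have w2 : 0 <= (p - a) * pairs S T by rewrite mulr_ge0 // subr_ge0.
  move: hp hm; rewrite !cutE !ler_norml => /andP[hp1 hp2] /andP[hm1 hm2] e1 e2.
  apply/andP; split; lra.
move/negbT: bal; rewrite /balanced negb_and -!leNgt -/s -/t => /orP[unb|unb].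
  apply: (le_trans (cut_col S T)); apply: far.
  by rewrite /sg [s * t]mulrC; exact: b320.
by apply: (le_trans (cut_row S T)); apply: far; exact: b320.
Qed.

Let kappa_le : d / 80 / 2 * (1 + 2 * ln 256%:R) + 4 * d / 256%:R <= d * (97 / 1000).
Proof.
have l256 : ln 256%:R = 8 * ln 2 :> R.
  by rewrite (_ : 256%N = (2 ^ 8)%N) // natrX lnXn ?ltr0n // mulr_natl.
have l2 : d * ln 2 <= d * (3 / 4) by rewrite ler_wpM2l ?ln2_le // ltW.
by rewrite l256; move: d0; lra.
Qed.

Let nonneg_form (x y : 'I_n -> R) : (forall i, 0 <= x i) -> (forall i, 0 <= y i) ->
  `|\sum_i \sum_j x i * y j * centered p G (i, j)| <=
  d * (97 / 2000) * (\sum_i x i ^+ 2 + \sum_j y j ^+ 2).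
Proof.
move=> x0 y0.
apply: (le_trans (@nonneg_form_le R _ (fun i j => centered p G (i, j)) 256 (d / 80) (4 * d)
   isT _ _ cut_mean cut_row cut_col x y x0 y0)).
- by rewrite divr_ge0 ?ler0n // ltW.
- by rewrite mulr_ge0 ?ler0n // ltW.
- apply: ler_wpM2r.
    by rewrite addr_ge0 // sumr_ge0 // => i _; exact: sqr_ge0.
  move: kappa_le; lra.
Qed.

Definition adjacency_entry (i j : 'I_n) : R := ((i, j) \in G)%:R + ((j, i) \in G)%:R.

Let upperG i j : ((i, j) \in G) -> (i < j)%N.
Proof. by move=> /(fintype.subsetP GGp) /upper. Qed.

(** The matrix A - p J is W + W^T minus p on the diagonal, and the last term has a
    favourable sign. *)
Let adjacency_form (x : 'I_n -> R) :
  \sum_i \sum_j x i * x j * (adjacency_entry i j - p) <=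
  2 * \sum_i \sum_j x i * x j * centered p G (i, j).
Proof.
have -> : 2 * (\sum_i \sum_j x i * x j * centered p G (i, j)) =
   \sum_i \sum_j x i * x j * (centered p G (i, j) + centered p G (j, i)).
  under [RHS]eq_bigr => i _ do under eq_bigr => j _ do rewrite mulrDr.
  under [RHS]eq_bigr => i _ do rewrite big_split /=.
  rewrite big_split /= mulr2n mulrDl mul1r; congr (_ + _).
  rewrite exchange_big /=; apply: eq_bigr => i _; apply: eq_bigr => j _.
  by rewrite [x j * _]mulrC.
apply: ler_sum => i _; apply: ler_sum => j _.
rewrite /adjacency_entry /centered /edge_prob /=.
case: (ltngtP i j) => [ij|ij|/val_inj ij].
- by rewrite subr0 le_eqVlt; apply/orP; left; apply/eqP; ring.
- by rewrite subr0 le_eqVlt; apply/orP; left; apply/eqP; ring.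
have -> : ((i, j) \in G) = false.
  by apply/negP => /upperG; rewrite ij ltnn.
have -> : ((j, i) \in G) = false.
  by apply/negP => /upperG; rewrite ij ltnn.
have p0 : 0 <= p := le_trans (ltW q0) (le_trans qa ap).
rewrite ij subr0 addr0 mulr0 add0r mulrN oppr_le0 mulr_ge0 //.
by rewrite -expr2 sqr_ge0.
Qed.

Let form0 (x : 'I_n -> R) : (forall i, 0 <= x i) ->
  \sum_i \sum_j x i * x j * (adjacency_entry i j - p) <= d / 5 * \sum_i x i ^+ 2.
Proof.
move=> x0; apply: (le_trans (adjacency_form x)).
have := nonneg_form x0 x0; rewrite ler_norml => /andP[_].
have : 0 <= d * \sum_i x i ^+ 2.
  by rewrite mulr_ge0 ?(ltW d0) // sumr_ge0 // => i _; exact: sqr_ge0.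
move: (\sum_i _) (\sum_i _) => X Y; lra.
Qed.

(** Splitting x into its positive and negative parts doubles the constant. *)
Let form (x : 'I_n -> R) :
  \sum_i \sum_j x i * x j * (adjacency_entry i j - p) <= 2 * d / 5 * \sum_i x i ^+ 2.
Proof.
pose xp i := Num.max (x i) 0; pose xm i := Num.max (- x i) 0.
have xp0 i : 0 <= xp i by rewrite le_max lexx orbT.
have xm0 i : 0 <= xm i by rewrite le_max lexx orbT.
have xE i : x i = xp i - xm i.
  rewrite /xp /xm; case: (lerP (x i) 0) => hx; case: (lerP (- x i) 0) => hx'; lra.
have x2 i : x i ^+ 2 = xp i ^+ 2 + xm i ^+ 2.
  have xpm : xp i * xm i = 0.
    rewrite /xp /xm; case: (lerP (x i) 0) => hx; rewrite ?mul0r //.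
    by case: (lerP (- x i) 0) => hx'; rewrite ?mulr0 //; lra.
  by rewrite xE sqrrB xpm mul0rn subr0.
apply: (le_trans (adjacency_form x)).
pose F (y z : 'I_n -> R) := \sum_i \sum_j y i * z j * centered p G (i, j).
have -> : \sum_i \sum_j x i * x j * centered p G (i, j) =
   F xp xp - F xp xm - F xm xp + F xm xm.
  rewrite /F -!sumrB -big_split /=; apply: eq_bigr => i _.
  rewrite -!sumrB -big_split /=; apply: eq_bigr => j _.
  by rewrite (xE i) (xE j); ring.
have := nonneg_form xp0 xp0; have := nonneg_form xp0 xm0.
have := nonneg_form xm0 xp0; have := nonneg_form xm0 xm0.
rewrite -/(F xp xp) -/(F xm xm) -/(F xp xm) -/(F xm xp).
under [X in _ -> _ -> _ -> _ -> _ <= _ * X]eq_bigr do rewrite x2.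
rewrite big_split /= !ler_norml.
have : 0 <= d * \sum_i xp i ^+ 2.
  by rewrite mulr_ge0 ?(ltW d0) // sumr_ge0 // => i _; exact: sqr_ge0.
have : 0 <= d * \sum_i xm i ^+ 2.
  by rewrite mulr_ge0 ?(ltW d0) // sumr_ge0 // => i _; exact: sqr_ge0.
move: (F xp xp) (F xm xm) (F xp xm) (F xm xp) (\sum_i xp i ^+ 2) (\sum_i xm i ^+ 2).
move=> f1 f2 f3 f4 X Y hX hY /andP[_ h1] /andP[h2 _] /andP[h3 _] /andP[_ h4].
lra.
Qed.

(** The rounded deviations are admissible integer vectors, so their sum of squares
    is below 256 n; rounding costs (m + 1) ^ 2 <= 2 (m ^ 2 + 1). *)
Let unspread r (H : {set edge}) : 0 <= r -> r <= 1 -> n%:R * r <= 2 * d ->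
  (forall i, degree R H i <= 4 * d) -> ~~ spread_degrees r K h H ->
  \sum_i centered_degree r H i ^+ 2 <= 514 * (n%:R * d).
Proof.
move=> r0 r1 nr degH /existsPn nspread.
pose D i := centered_degree r H i.
have absD i : `|D i| <= 4 * d.
  have deg0 : 0 <= degree R H i by apply: sumr_ge0 => e _; rewrite addr_ge0.
  have nrr : 0 <= n%:R * r - r by rewrite subr_ge0 ler_peMl // ler1n.
  have := degH i; rewrite /D centered_degreeE ler_norml => dH.
  apply/andP; split; move: d0; lra.
pose m i := Num.truncn (`|D i| / h).
have mi i : (m i)%:R * h <= `|D i| /\ `|D i| < ((m i)%:R + 1) * h.
  have /truncn_itv/andP[h1 h2] : 0 <= `|D i| / h by rewrite divr_ge0 // ltW.
  by rewrite -ler_pdivlMr // -ltr_pdivrMr // natr1.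
have mK i : (m i < K.+1)%N.
  by rewrite ltnS KE; apply: le_truncn; rewrite ler_pdivrMr // -mulrA -expr2 hd.
have := nspread [ffun i => (D i < 0, inord (m i))].
rewrite negb_and -ltNge => /orP[lt|/forallPn[i]]; last first.
  by rewrite ffunE /= inordK // -/(D i) -normrEsign (mi i).1.
have m2 : \sum_i ((m i)%:R : R) ^+ 2 <= 256 * n%:R.
  apply: le_trans (ltW lt); apply: ler_sum => i _.
  by rewrite ffunE /= inordK.
apply: (@le_trans _ _ (\sum_i 2 * d * ((m i)%:R ^+ 2 + 1))).
  apply: ler_sum => i _; rewrite -/(D i) -[D i ^+ 2]real_normK ?num_real //.
  apply: (@le_trans _ _ ((((m i)%:R + 1) * h) ^+ 2)).
    have m0 : 0 <= (m i)%:R + 1 :> R by rewrite addr_ge0.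
    apply: lerXn2r; rewrite ?nnegrE ?mulr_ge0 ?(ltW h0) //.
    exact: ltW (mi i).2.
  rewrite exprMn hd mulrC [2 * d]mulrC -mulrA; apply: ler_wpM2l; first exact: ltW.
  have := sqr_ge0 ((m i)%:R - 1 : R); rewrite sqrrB sqrrD; lra.
rewrite -mulr_sumr big_split /= sumr_const card_ord.
have := ler_wpM2l (ltW d0) m2; lra.
Qed.

(** The graph at p lies between the graphs at a and b, so every deviation at p is
    bounded by the deviations at the grid points and the change n (b - a) <= h of
    the mean degree. *)
Lemma perron_close (v : 'I_n -> R) (lam : R) :
  (forall i, 0 <= v i) -> \sum_i v i ^+ 2 = 1 ->
  (forall j, \sum_i v i * adjacency_entry i j = lam * v j) ->
  \sum_i (v i - 1 / Num.sqrt n%:R) ^+ 2 <= 14 * 2100 / d.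
Proof.
move=> v0 v1 eig.
have rowE i : \sum_j adjacency_entry i j = degree R G i by rewrite degreeE.
have a0 : 0 <= a := le_trans (ltW q0) qa.
have b0 : 0 <= b := le_trans a0 (le_trans ap pb).
have b1 : b <= 1 := le_trans b2q q2.
have a1 : a <= 1 := le_trans (le_trans ap pb) b1.
have nb : n%:R * b <= 2 * d by rewrite dE mulrCA ler_pM2l.
have na : n%:R * a <= 2 * d by apply: le_trans nb; rewrite ler_pM2l // (le_trans ap).
have devm : \sum_i centered_degree a Gm i ^+ 2 <= 514 * (n%:R * d).
  apply: unspread => // [i|]; first by case/and4P: typm => /forallP /(_ i).
  by case/and4P: typm.
have devp : \sum_i centered_degree b Gp i ^+ 2 <= 514 * (n%:R * d).
  apply: unspread => // [i|]; first by case/and4P: typp => /forallP /(_ i).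
  by case/and4P: typp.
have res : \sum_i (\sum_j adjacency_entry i j - n%:R * p) ^+ 2 <= 2100 * (n%:R * d).
  apply: (@le_trans _ _ (\sum_i (2 * (centered_degree a Gm i ^+ 2 +
      centered_degree b Gp i ^+ 2) + 4 * d))).
    apply: ler_sum => i _; rewrite rowE !centered_degreeE.
    have := degree_mono i GmG; have := degree_mono i GGp.
    move: (degree R Gm i) (degree R G i) (degree R Gp i) => x y z yz xy.
    have n1 : 1 <= n%:R :> R by rewrite ler1n.
    have h1000 : 1000 <= h.
      rewrite -(@ler_pXn2r _ 2) ?nnegrE ?ler0n ?(ltW h0) // hd.
      by move: d_large; lra.
    have e1 : y - n%:R * p <= (z - (n%:R * b - b)) + (h + 1).
      have : n%:R * b - n%:R * p <= h.
        by apply: le_trans nab; rewrite -mulrBr ler_pM2l // lerD2l lerN2.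
      by move: b0; lra.
    have e2 : (x - (n%:R * a - a)) - (h + 1) <= y - n%:R * p.
      have : n%:R * p - n%:R * a <= h.
        by apply: le_trans nab; rewrite -mulrBr ler_pM2l // lerD2r.
      by move: a1; lra.
    have h2 : (h + 1) ^+ 2 <= 2 * d by rewrite -hd; nra.
    move: (z - _) (x - _) (y - _) (h + 1) h2 e1 e2 => Z X Y H h2 e1 e2.
    have := sqr_ge0 (Z - H); have := sqr_ge0 (X + H).
    have := sqr_ge0 X; have := sqr_ge0 Z.
    have [Y0|Y0] := lerP 0 Y.
      have : Y ^+ 2 <= (Z + H) ^+ 2 by rewrite lerXn2r ?nnegrE ?(le_trans Y0).
      lra.
    have : (- Y) ^+ 2 <= (H - X) ^+ 2 by apply: lerXn2r; rewrite ?nnegrE; lra.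
    rewrite sqrrN; lra.
  rewrite big_split /= -mulr_sumr big_split /= sumr_const card_ord -[_ *+ n]mulr_natl.
  have nd0 : 0 <= n%:R * d by rewrite mulr_ge0 // ltW.
  have -> : n%:R * (4 * d) = 4 * (n%:R * d) by ring.
  move: (n%:R * d) nd0 devm devp => *; lra.
have D0 : 0 < d ^+ 2 by rewrite exprn_gt0.
apply: (le_trans (@perron_perturbation R n adjacency_entry v lam p d n0 d0 _ _ v0 v1 eig
   _ form0 form _)).
- rewrite p_n andbT dE ler_pM2l //; exact: le_trans ap.
- by move=> i j; rewrite /adjacency_entry addrC.
- by move=> i; rewrite rowE.
- apply: (le_trans res); rewrite mulrCA ler_pM2l // expr_div_n.
  by move: d_large D0 d0; rewrite expr2 => *; nra.
have -> : 14 * 2100 / d = 14 / d ^+ 2 * (2100 * d).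
  by field; rewrite lt0r_neq0.
apply: ler_wpM2l; first by rewrite divr_ge0 ?ler0n // ltW.
by rewrite ler_pdivrMr // -mulrA [d * _]mulrC.
Qed.

End Sandwich.

(** * The law of the threshold graphs *)

Local Open Scope classical_set_scope.

Section EdgeLaw.
Context (R : realType) (d : measure_display) (T : measurableType d)
  (P : probability T R).

Lemma uniform01_lt (X : {RV P >-> R}) (p : R) : uniform01 X -> 0 <= p <= 1 ->
  P (X @^-1` [set x | x < p]) = p%:E.
Proof.
move=> uX /andP[p0 p1].
have -> : [set x | x < p] = `]-oo, p[ :> set R by apply/seteqP; split => x; rewrite /= in_itv.
have -> : P (X @^-1` `]-oo, p[) = distribution P X `]-oo, p[ by [].
rewrite uX // /uniform_prob integral_uniform_pdf.
have -> : `]-oo, p[ `&` `[0, 1] = `[0, p[ :> set R.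
  apply/seteqP; split => x; rewrite /= !in_itv /=.
    by move=> [-> /andP[->]].
  by move=> /andP[x0 xp]; rewrite x0 xp (ltW (lt_le_trans xp p1)).
rewrite (eq_integral (cst 1%E)); last first.
  move=> x; rewrite inE /= in_itv /= => /andP[x0 xp].
  by rewrite /uniform_pdf x0 (ltW (lt_le_trans xp p1)) /= subr0 invr1.
rewrite integral_cst //= lebesgue_measure_itv /= lte_fin mul1e.
case: ltgtP p0 => // [|<-] _; last by [].
by rewrite oppr0 addr0.
Qed.

Lemma union_le (K : eqType) (s : seq K) (E : K -> set T) (b : K -> R) :
  (forall k, k \in s -> measurable (E k)) ->
  (forall k, k \in s -> (P (E k) <= (b k)%:E)%E) ->
  measurable [set w | exists2 k, k \in s & E k w] /\
  (P [set w | exists2 k, k \in s & E k w] <= (\sum_(k <- s) b k)%:E)%E.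
Proof.
elim: s => [|x s IH] mE bE.
  have -> : [set w | exists2 k, k \in [::] & E k w] = set0.
    by apply/seteqP; split => w //= -[].
  by rewrite big_nil measure0; split.
have -> : [set w | exists2 k, k \in x :: s & E k w] =
    E x `|` [set w | exists2 k, k \in s & E k w].
  apply/seteqP; split => w /=.
    by move=> [k]; rewrite inE => /orP[/eqP -> Ex|ks Ek]; [left|right; exists k].
  by move=> [Ex|[k ks Ek]]; [exists x|exists k] => //; rewrite inE ?eqxx ?ks ?orbT.
have xs : x \in x :: s by rewrite inE eqxx.
have [mU bU] := IH (fun k ks => mE k (mem_behead (ks : k \in behead (x :: s))))
   (fun k ks => bE k (mem_behead (ks : k \in behead (x :: s)))).
split; first by apply: measurableU => //; exact: mE.
apply: (le_trans (measureU2 _ (mE _ xs) mU)).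
by rewrite big_cons EFinD leeD // bE.
Qed.

Context (n : nat) (U : 'I_n -> 'I_n -> {RV P >-> R}).
Hypothesis iidU : iid_uniform_edges U.

Definition threshold_graph (p : R) (w : T) : {set 'I_n * 'I_n} :=
  [set e : 'I_n * 'I_n | (e.1 < e.2)%N && (U e.1 e.2 w < p)]%SET.

(** For G made of increasing pairs the event is the intersection over the edges e of
    U_e < p or of its complement, to which independence applies; for the other G
    it is empty. *)
Lemma threshold_graph_law (p : R) (G : {set 'I_n * 'I_n}) : 0 <= p <= 1 ->
  measurable [set w | threshold_graph p w = G] /\
  (P [set w | threshold_graph p w = G] <= (bernoulli_weight (edge_prob p) G)%:E)%E.
Proof.
move=> p01; have [p0 p1] := andP p01.
pose D : {set 'I_n * 'I_n} := [set e : 'I_n * 'I_n | (e.1 < e.2)%N]%SET.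
have w0 : (0 <= bernoulli_weight (edge_prob p) G)%R.
  by apply: bernoulli_weight_ge0 => e; exact: edge_prob01.
have [GD|GD] := boolP (G \subset D); last first.
  have -> : [set w | threshold_graph p w = G] = set0.
    apply/seteqP; split => w //= gG; move/negP: GD; apply.
    by apply/fintype.subsetP => e; rewrite -gG !inE => /andP[].
  by rewrite measure0 lee_fin; split.
pose B (e : 'I_n * 'I_n) : set R :=
  if e \in G then [set x | x < p] else ~` [set x | x < p].
have mlt : measurable [set x : R | x < p].
  have -> : [set x | x < p] = `]-oo, p[ :> set R.
    by apply/seteqP; split => x; rewrite /= in_itv.
  exact: measurable_itv.
have mB e : measurable (B e) by rewrite /B; case: ifP => _ //; exact: measurableC.
have eqG : [set w | threshold_graph p w = G] =
    \bigcap_(e in [set` D]) ((U e.1 e.2) @^-1` B e).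
  apply/seteqP; split => w /=.
    move=> gG e; rewrite /= /B -gG !inE => eD; rewrite eD /=.
    by case: ifP => // /negP.
  move=> h; apply/setP => e; rewrite inE.
  have [eD|eD] := boolP (e.1 < e.2)%N; last first.
    apply/esym/negP => /(fintype.subsetP GD); rewrite inE => h'.
    by rewrite h' in eD.
  have := h e; rewrite /= /B inE => /(_ eD).
  by case: (e \in G) => [->//|] /negP /negbTE.
have [unif indep] := iidU.
split.
  rewrite eqG; apply: fin_bigcap_measurable => // e _; exact: measurable_funPTI.
rewrite eqG (indep D B) //.
rewrite (eq_bigr (fun e : 'I_n * 'I_n =>
   (if e \in G then edge_prob p e else 1 - edge_prob p e)%:E)); last first.
  move=> e; rewrite inE => eD; rewrite /B /edge_prob eD; case: ifP => _.
    by rewrite uniform01_lt //; exact: unif.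
  rewrite -[_ @^-1` _]/(~` ((U e.1 e.2) @^-1` [set x | x < p])).
  rewrite probability_setC; last exact: measurable_funPTI.
  by rewrite uniform01_lt //; exact: unif.
rewrite prodEFin lee_fin /bernoulli_weight le_eqVlt; apply/orP; left; apply/eqP.
rewrite [RHS](bigID (mem D)) /= [X in _ = _ * X]big1 ?mulr1 // => e eD.
rewrite ifN; first by move: eD; rewrite inE /edge_prob => /negbTE ->; rewrite subr0.
by apply: contra eD; exact: (fintype.subsetP GD).
Qed.

Lemma threshold_graph_pr (p : R) (Q : {set 'I_n * 'I_n} -> bool) : 0 <= p <= 1 ->
  measurable [set w | Q (threshold_graph p w)] /\
  (P [set w | Q (threshold_graph p w)] <= (bernoulli_pr (edge_prob p) Q)%:E)%E.
Proof.
move=> p01.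
have -> : [set w | Q (threshold_graph p w)] =
   [set w | exists2 G, G \in enum Q & threshold_graph p w = G].
  apply/seteqP; split => w /=.
    by move=> Qw; exists (threshold_graph p w) => //; rewrite mem_enum.
  by move=> [G]; rewrite mem_enum => QG ->.
rewrite /bernoulli_pr.
have [] := @union_le _ (enum Q) (fun G => [set w | threshold_graph p w = G])
   (bernoulli_weight (edge_prob p)).
- by move=> G _; case: (threshold_graph_law G p01).
- by move=> G _; case: (threshold_graph_law G p01).
move=> h1 h2; split => //; apply: (le_trans h2); rewrite lee_fin.
by rewrite big_enum /=.
Qed.

End EdgeLaw.

(** * Union bound over the grid *)

Local Open Scope ring_scope.

Lemma grid_bracket (R : realType) (g : nat -> R) (x : R) (N : nat) :
  g 0%N <= x -> x <= g N -> (0 < N)%N ->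
  exists2 k, (k < N)%N & g k <= x <= g k.+1.
Proof.
move=> g0; elim: N => // N IH xN _.
have [xle|xgt] := leP (g N) x; first by exists N; rewrite ?ltnSn ?xle.
case: N IH xN xgt => [|N] IH xN xgt; first by move: xgt; rewrite ltNge g0.
by have [k kN hk] := IH (ltW xgt) isT; exists k => //; exact: ltnW.
Qed.

Lemma l2norm_sub_sqr (R : realType) (n : nat) (v : 'rV[R]_n) (c : R) :
  l2norm (v - const_mx c) = Num.sqrt (\sum_i (v 0 i - c) ^+ 2).
Proof. by rewrite /l2norm; congr Num.sqrt; apply: eq_bigr => i _; rewrite !mxE. Qed.

Lemma nonneg_unit_dist_le (R : realType) (n : nat) (v : 'I_n -> R) : (0 < n)%N ->
  (forall i, 0 <= v i) -> \sum_i v i ^+ 2 = 1 ->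
  \sum_i (v i - 1 / Num.sqrt n%:R) ^+ 2 <= 2.
Proof.
move=> n0 v0 v1; set u := 1 / Num.sqrt n%:R.
have nR : 0 < n%:R :> R by rewrite ltr0n.
have u0 : 0 <= u by rewrite divr_ge0 // sqrtr_ge0.
have u2 : n%:R * u ^+ 2 = 1.
  by rewrite expr_div_n sqr_sqrtr ?ltW // expr1n mul1r divff // lt0r_neq0.
apply: (@le_trans _ _ (\sum_i (v i ^+ 2 + u ^+ 2))).
  apply: ler_sum => i _; have := mulr_ge0 (v0 i) u0; lra.
by rewrite big_split /= v1 sumr_const card_ord -[_ *+ n]mulr_natl u2.
Qed.

Theorem lemma4 (R : realType) (d : measure_display) (T : measurableType d)
    (P : probability T R) (n : nat) (U : 'I_n -> 'I_n -> {RV P >-> R})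
    (q : R) (v : R -> T -> 'rV[R]_n) :
  (7 <= n)%N ->
  iid_uniform_edges U ->
  q \in `[4 * ln n%:R / n%:R, 1 / 2] ->
  (forall (p : R) (w : T), p \in `[q, 2 * q] ->
     perron_vector (adjacency U p w) (v p w)) ->
  with_probability_ge P (1 - 4 * expR (- (n%:R * q / 64)))
    [set w | (ereal_sup [set (l2norm (v p w - const_mx (1 / Num.sqrt n%:R)))%:E
                        | p in `[q, (2 * q)%R]]
              <= (2896 / Num.sqrt (n%:R * q))%:E)%E].
Proof.
move=> n7 iidU; rewrite in_itv /= => /andP[lnq q12] perron.
(* The numeral is kept opaque, as unfolding it is costly. *)
have [c cE] : exists c : R, c = 2896 by exists 2896.
have c0 : 0 < c by rewrite cE ltr0n.
rewrite -cE.
have n0 : (0 < n)%N by exact: leq_trans n7.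
have nR : 0 < n%:R :> R by rewrite ltr0n.
have q0 : 0 < q.
  apply: lt_le_trans lnq; rewrite divr_gt0 // mulr_gt0 // ln_gt0 // ltr1n.
  exact: leq_trans n7.
set D := n%:R * q.
have D0 : 0 < D by rewrite mulr_gt0.
have h0 : 0 < Num.sqrt D by rewrite sqrtr_gt0.
set h := Num.sqrt D in h0 *.
have hD : h ^+ 2 = D by rewrite sqr_sqrtr // ltW.
have reduce (E : set T) : measurable E ->
    ((1 - 4 * expR (- (D / 64)))%:E <= P E)%E ->
    (forall w p, E w -> q <= p <= 2 * q ->
       \sum_i (v p w 0 i - 1 / Num.sqrt n%:R) ^+ 2 <= c ^+ 2 / D) ->
    with_probability_ge P (1 - 4 * expR (- (D / 64)))
    [set w | (ereal_sup [set (l2norm (v p w - const_mx (1 / Num.sqrt n%:R)))%:E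
                        | p in `[q, (2 * q)%R]]
              <= (c / h)%:E)%E].
  move=> mE PE bound; exists E; split => // w Ew /=.
  apply: ge_ereal_sup => _ [p /= pq <-]; rewrite lee_fin l2norm_sub_sqr.
  rewrite -(@ler_pXn2r _ 2) ?nnegrE ?sqrtr_ge0 //; last by rewrite divr_ge0 ?ltW.
  rewrite sqr_sqrtr; last by apply: sumr_ge0 => i _; exact: sqr_ge0.
  rewrite expr_div_n hD; apply: bound => //.
have perron_data w p : q <= p <= 2 * q -> [/\ forall i, 0 <= v p w 0 i,
    \sum_i v p w 0 i ^+ 2 = 1 &
    exists a, forall j, \sum_i v p w 0 i * adjacency U p w i j = a * v p w 0 j].
  move=> pq; have [|a [_ eig nrm v0]] := perron p w; first by rewrite in_itv.
  split => //.
    have /(congr1 (fun x => x ^+ 2)) := nrm; rewrite /l2norm sqr_sqrtr ?expr1n //.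
    by apply: sumr_ge0 => i _; exact: sqr_ge0.
  exists a => j; move/eigenspaceP: eig => /rowP /(_ j); rewrite !mxE => <-.
  by [].
(* In this range the bound exceeds the largest possible distance sqrt 2. *)
have [Dsmall|Dbig] := leP D (c ^+ 2 / 2).
  apply: (reduce setT) => //.
    by rewrite probability_setT lee_fin gerBl mulr_ge0 ?expR_ge0.
  move=> w p _ pq; have [v0 v1 _] := perron_data w p pq.
  apply: (le_trans (nonneg_unit_dist_le n0 v0 v1)).
  rewrite ler_pdivlMr //; move: Dsmall; lra.
have D4 : 4 * 10 ^+ 6 <= D by move: Dbig; rewrite cE; lra.
have h2000 : 2000 <= h.
  rewrite -(@ler_pXn2r _ 2) ?nnegrE ?ler0n ?(ltW h0) // hD; lra.
have Dn : 2 * D <= n%:R.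
  by rewrite /D mulrCA ler_piMr ?(ltW nR) //; lra.
have nexp : n%:R <= expR (D / 4).
  rewrite -[leLHS]lnK ?posrE // ler_expR; move: lnq; rewrite ler_pdivrMr // /D; lra.
pose N := (Num.truncn h).+1.
have NR : 0 < N%:R :> R by rewrite ltr0n.
have hN : h <= N%:R by rewrite ltW // truncnS_gt.
have Nh : N%:R <= h + 1 by rewrite -natr1 lerD2r truncn_le // ltW.
(* About h steps are needed for the mean degree to move by at most h in one
   step. *)
pose g (k : nat) : R := q + q * (k%:R / N%:R).
have g0 : g 0%N = q by rewrite /g mul0r mulr0 addr0.
have gN : g N = 2 * q by rewrite /g divff ?lt0r_neq0 //; ring.
have gstep k : g k.+1 - g k = q / N%:R by rewrite /g -natr1; field; rewrite lt0r_neq0.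
have gq k : (k <= N)%N -> q <= g k <= 2 * q.
  move=> kN; have k0 : 0 <= k%:R / N%:R :> R by rewrite divr_ge0.
  have k1 : k%:R / N%:R <= 1 :> R by rewrite ler_pdivrMr // mul1r ler_nat.
  apply/andP; split; first by rewrite /g lerDl mulr_ge0 // ltW.
  have := ler_wpM2l (ltW q0) k1; rewrite /g; lra.
pose K := Num.truncn (4 * h).
have K4 : K%:R <= 4 * h by rewrite truncn_le // mulr_ge0 ?ler0n // ltW.
pose atypical (k : nat) := [set w | ~~ typical (g k) D h K (threshold_graph U (g k) w)].
have p01 k : (k <= N)%N -> 0 <= g k <= 1.
  move=> /gq /andP[h1 h2]; apply/andP; split; lra.
have bad_k (k : nat) : k \in iota 0 N.+1 -> measurable (atypical k) /\
    (P (atypical k) <= (8 * expR (- (D / 50)))%:E)%E.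
  rewrite mem_iota /= add0n ltnS => kN; have gk := p01 k kN.
  have [mA PA] := threshold_graph_pr iidU (fun G => ~~ typical (g k) D h K G) gk.
  split => //; apply: (le_trans PA); rewrite lee_fin.
  have /andP[h1 h2] := gq k kN; have /andP[h3 h4] := gk.
  apply: atypical_tail => //.
    by rewrite /D ler_pM2l.
  by rewrite /D mulrCA ler_pM2l.
have [mbad Pbad] := @union_le _ _ _ P _ (iota 0 N.+1) atypical
  (fun=> 8 * expR (- (D / 50)))
  (fun k hk => (bad_k k hk).1) (fun k hk => (bad_k k hk).2).
set bad := [set w | exists2 k, k \in iota 0 N.+1 & atypical k w] in mbad Pbad.
apply: (reduce (~` bad)); first exact: measurableC.
  rewrite probability_setC // EFinB leeB // (le_trans Pbad) // lee_fin.
  rewrite big_const_seq count_predT size_iota iter_addr_0 -[_ *+ _]mulr_natl.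
  have -> : expR (- (D / 50)) = expR (- (D / 64)) * expR (- (7 / 1600 * D)).
    by rewrite -expRD; congr expR; lra.
  have e64 := expR_ge0 (- (D / 64)).
  (* The number of grid points, of order sqrt D, is absorbed by the gap between
     1 / 50 and 1 / 64. *)
  have key : N.+1%:R * expR (- (7 / 1600 * D)) <= 1 / 2.
    rewrite expRN ler_pdivrMr ?expR_gt0 // -natr1.
    have := expR_ge1Dx (7 / 1600 * D); move: Nh h2000; rewrite -hD; nra.
  have := ler_wpM2l e64 key.
  move: (expR (- (D / 64))) (expR (- (7 / 1600 * D))) (N.+1%:R : R) => x y z; lra.
move=> w p nbad pq; have [v0 v1 [lam eig]] := perron_data w p pq.
have [qp p2q] := andP pq.
have [k kN /andP[gkp pgk]] : exists2 k, (k < N)%N & g k <= p <= g k.+1.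
  by apply: grid_bracket; rewrite ?g0 ?gN.
have typ j : (j <= N)%N -> typical (g j) D h K (threshold_graph U (g j) w).
  move=> jN; apply/negPn/negP => nt; apply: nbad; exists j => //.
  by rewrite mem_iota /= add0n ltnS.
have sub (x y : R) : x <= y -> threshold_graph U x w \subset threshold_graph U y w.
  move=> xy; apply/fintype.subsetP => e; rewrite !inE => /andP[-> /= ux].
  exact: lt_le_trans ux xy.
have /andP[qg _] := gq k (ltnW kN); have /andP[_ g2q] := gq k.+1 kN.
have close := @perron_close R n (g k) p (g k.+1) q D h K
  (threshold_graph U (g k) w) (threshold_graph U p w) (threshold_graph U (g k.+1) w)
  n0 q0 erefl h0 hD D4 _ qg gkp pgk g2q _ _ erefl (sub _ _ gkp) (sub _ _ pgk) _
  (typ k (ltnW kN)) (typ k.+1 kN) (fun i => v p w 0 i) lam v0 v1 _.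
apply: (le_trans (close _ _ _ _ _)).
- lra.
- rewrite gstep ler_pM2l // lef_pV2 ?posrE ?ltr0n //; lra.
- by rewrite gstep mulrA -/D ler_pdivrMr // -hD expr2 ler_pM2l.
- by move=> e; rewrite inE => /andP[].
- move=> j; rewrite -eig; apply: eq_bigr => i _; congr (_ * _).
  rewrite mxE /adjacency_entry !inE /=.
  by case: ltngtP => ij; rewrite ?addr0 ?add0r.
by rewrite ler_pM2r ?invr_gt0 // cE; lra.
Qed.
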